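(* Let $p\ge 3$ and let $\phi:[0,\infty)\to\mathbb{R}$ be differentiable with $\phi(w)<p-2$ for all $w> 0$, and consider the estimator $\hat\theta_\phi(X)=\bigl(1-\phi(\|X\|^2)/\|X\|^2\bigr)X$. Assume: (A.1) $\phi'(w)\ge 0$ for all $w\ge 0$; (A.2) $\phi(w)\ge 0$ for all $w\ge 0$; (A.4) $\lim_{w\to\infty}\phi(w)=p-2$; (A.6) the function $w\mapsto w\phi'(w)/\{p-2-\phi(w)\}^2$ is monotone non-decreasing on $(0,\infty)$; (A.7) $R(0,\hat\theta_{\mathrm{JS}})\ge R(0,\hat\theta_\phi)$ (dominance at the origin). Then $\hat\theta_\phi$ dominates the James--Stein estimator, i.e. $R(\theta,\hat\theta_\phi)\le R(\theta,\hat\theta_{\mathrm{JS}})$ for all $\theta\in\mathbb{R}^p$.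
   Context: Let $X\sim\mathcal{N}_p(\theta,I_p)$ with $\theta\in\mathbb{R}^p$, $p\ge 3$. The loss is quadratic, and the risk of an estimator $\hat\theta$ is $R(\theta,\hat\theta)=\mathrm{E}_\theta[\|\hat\theta(X)-\theta\|^2]$. The James--Stein estimator is $\hat\theta_{\mathrm{JS}}(X)=\bigl(1-(p-2)/\|X\|^2\bigr)X$. For a function $\phi$ on $[0,\infty)$, $\hat\theta_\phi(X)=\bigl(1-\phi(\|X\|^2)/\|X\|^2\bigr)X$. *)

(* Defs.v *)
From HB Require Import structures.
From mathcomp Require Import all_boot all_order all_algebra.
From mathcomp Require Import all_classical all_reals all_analysis.
Set Implicit Arguments. Unset Strict Implicit. Unset Printing Implicit Defensive.
Import Order.TTheory GRing.Theory Num.Theory.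
Import numFieldNormedType.Exports.
Local Open Scope classical_set_scope.
Local Open Scope ring_scope.

Section JS.
Context {R : realType} (p : nat).

Definition sqnorm (x : 'rV[R]_p) : R := \sum_(i < p) x 0 i ^+ 2.

(* theta_phi(X) = (1 - phi(|X|^2)/|X|^2) X  (at X = 0, MathComp's 0^-1 = 0
   gives X; a null set, irrelevant for the risk) *)
Definition est_phi (phi : R -> R) (x : 'rV[R]_p) : 'rV[R]_p :=
  (1 - phi (sqnorm x) / sqnorm x) *: x.

Definition est_JS : 'rV[R]_p -> 'rV[R]_p := est_phi (fun _ => (p - 2)%:R).

Definition upd (v : nat -> R) (i : nat) (x : R) : nat -> R :=
  fun j => if j == i then x else v j.

(* iterated integral of f against the product of the N(th j, 1) laws,
   j = 0 .. n-1 (the law of a vector with independent N(th j,1) coords) *)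
Fixpoint iter_gauss (th : nat -> R) (n : nat) (f : (nat -> R) -> \bar R)
  : \bar R :=
  match n with
  | 0 => f (fun _ => 0)
  | n'.+1 => (\int[normal_prob (th n') 1]_x
                iter_gauss th n' (fun v => f (upd v n' x)))%E
  end.

Definition coords (theta : 'rV[R]_p) (j : nat) : R :=
  match @insub nat (fun j => j < p)%N 'I_p j with
  | Some i => theta 0 i | None => 0 end.

(* E_theta[ g(X) ] for X ~ N_p(theta, I_p), g nonnegative (extended-real) *)
Definition gauss_expect (theta : 'rV[R]_p) (g : 'rV[R]_p -> \bar R) : \bar R :=
  iter_gauss (coords theta) p (fun v => g (\row_(i < p) v i)).

Definition risk (theta : 'rV[R]_p) (d : 'rV[R]_p -> 'rV[R]_p) : \bar R :=
  gauss_expect theta (fun x => (sqnorm (d x - theta))%:E).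

End JS.

(* Main.v *)
(** By Stein's identity the risk difference between the James-Stein estimator
    and the estimator given by [phi] is the expectation of
    [gain w = 4 phi'(w) - (p - 2 - phi w)^2 / w] at [w = |X|^2].  By (A.6) the
    sign of [gain] changes at most once, from negative to nonnegative, while the
    law of [|X|] has monotone likelihood ratio in [|theta|]; hence a nonnegative
    expectation at the origin forces one everywhere.

    Both facts are read off in polar coordinates.  Stein's identity becomes, on
    each ray, the vanishing of the integral of a derivative, and the likelihood
    ratio of the radius is a mixture of [cosh (r s.theta)] over directions [s].
    The derivative of [phi] is continuous because, by (A.6), it comes from a
    derivative that is monotone up to a continuous factor. *)
Require Import Defs.
From HB Require Import structures.
From mathcomp Require Import all_boot all_order all_algebra.
From mathcomp Require Import all_classical all_reals all_analysis.
From mathcomp Require Import measurable_realfun measurable_fun_approximation.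
From mathcomp Require Import simple_functions ring lra.
Import Order.TTheory GRing.Theory Num.Theory.
Import numFieldNormedType.Exports.
Local Open Scope classical_set_scope.
Local Open Scope ring_scope.

(** * Iterated Gaussian integrals *)

(** Neither risk is known to be finite in advance, so Stein's identity cannot start as a difference.
    It is kept additive, with [gain = gainp - gainn] split over the two sides: loss of [phi] plus
    [gainp] against James-Stein loss plus [gainn], all nonnegative and equal in the extended reals.
    Only the James-Stein side has to be estimated, through [gainn w <= (p - 2)^2 / w]; its
    finiteness then licenses the subtraction. The condition [p >= 3] enters at radius 0:
    [r^(p-1) / r^2] stays bounded there and the flux [r^(p-2)] vanishes. Sequences carry no
    sigma-algebra, so iterated integrals are transported to a probability space; one standard
    Gaussian vector [Z] there serves all means, the mean surviving only as a weight. The final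
    comparison freezes the likelihood ratio at the radius where the gain changes sign: it is at most
    this value before that radius and at least this value after it. *)

Section normal_integral.
Context {R : realType}.
Local Notation mu := (@lebesgue_measure R).
Local Open Scope ereal_scope.
Variable m : R.

Import HBNNSimple.

Lemma integral_normal_prob_indic (E : set (measurableTypeR R)) : measurable E ->
  \int[normal_prob m 1]_x (\1_E x)%:E =
  \int[mu]_x ((\1_E x)%:E * (normal_pdf m 1 x)%:E).
Proof.
move=> mE; rewrite integral_indic//= /normal_prob setIT [LHS]integral_mkcond.
apply: eq_integral => x _; rewrite patchE indicE.
by case: ifPn => xE; rewrite ?mul1e ?mul0e.
Qed.

(** The standard ladder: indicators, then simple functions by linearity, then [f] by monotone
    convergence along [nnsfun_approx], so that the value [+oo] is allowed. *)
Lemma integral_normal_prob (f : R -> \bar R) : measurable_fun [set: R] f ->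
  (forall x, 0 <= f x) ->
  \int[normal_prob m 1]_x f x = \int[mu]_x (f x * (normal_pdf m 1 x)%:E).
Proof.
move=> mf f0.
have mpdf : measurable_fun [set: R] (EFin \o normal_pdf m 1).
  by apply/measurable_EFinP; exact: measurable_normal_pdf.
have pdf0 x : 0 <= (normal_pdf m 1 x)%:E by rewrite lee_fin normal_pdf_ge0.
pose f_ := @nnsfun_approx _ (measurableTypeR R) R setT measurableT f mf.
transitivity (limn (fun n => \int[normal_prob m 1]_x (f_ n x)%:E)).
  rewrite -monotone_convergence//.
  - apply: eq_integral => x _; apply/esym/cvg_lim => //=.
    exact: cvg_nnsfun_approx.
  - by move=> n; exact/measurable_EFinP/measurable_funTS.
  - by move=> n x _; rewrite lee_fin.
  - by move=> x _ i j ij; rewrite lee_fin; exact/lefP/nd_nnsfun_approx.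
transitivity (limn (fun n => \int[mu]_x ((f_ n x)%:E * (normal_pdf m 1 x)%:E))); last first.
  rewrite -monotone_convergence//.
  - apply: eq_integral => x _; apply/cvg_lim => //=.
    by apply: cvgeZr => //; exact: cvg_nnsfun_approx.
  - move=> n; apply: emeasurable_funM => //.
    exact/measurable_EFinP/measurable_funTS.
  - by move=> n x _; rewrite mule_ge0// lee_fin.
  - move=> x _ i j ij; rewrite lee_wpmul2r// lee_fin.
    exact/lefP/nd_nnsfun_approx.
congr (limn _); apply/funext => n.
transitivity (\sum_(k \in range (f_ n))
    \int[normal_prob m 1]_x (k * \1_(f_ n @^-1` [set k]) x)%:E).
  under eq_integral do rewrite fimfunE -fsumEFin//.
  rewrite ge0_integral_fsum//.
  - by move=> r; exact/measurable_EFinP/measurable_funM.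
  - by move=> r x _; rewrite nnfun_muleindic_ge0.
transitivity (\sum_(k \in range (f_ n))
    \int[mu]_x ((k * \1_(f_ n @^-1` [set k]) x)%:E * (normal_pdf m 1 x)%:E)).
  apply: eq_fsbigr => r /[!inE] -[y _ <-].
  under eq_integral do rewrite EFinM.
  under [RHS]eq_integral do rewrite EFinM -muleA.
  rewrite !ge0_integralZl//.
  - by rewrite integral_normal_prob_indic.
  - by apply: emeasurable_funM => //; exact/measurable_EFinP.
  - by move=> x _; rewrite mule_ge0// lee_fin.
  - by rewrite lee_fin.
  - exact/measurable_EFinP.
  - by rewrite lee_fin.
rewrite -ge0_integral_fsum//.
- apply: eq_integral => x _.
  rewrite -ge0_mule_fsuml; last by move=> r; rewrite nnfun_muleindic_ge0.
  by congr (_ * _); rewrite fsumEFin// -fimfunE.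
- move=> r; apply: emeasurable_funM => //.
  exact/measurable_EFinP/measurable_funM.
- by move=> r x _; rewrite mule_ge0// nnfun_muleindic_ge0.
Qed.

Lemma normal_pdf1E x :
  normal_pdf m 1 x = (normal_peak 1 * expR (- (x - m) ^+ 2 / 2))%R.
Proof.
by rewrite normal_pdfE ?oner_eq0// /normal_fun expr1n.
Qed.

End normal_integral.

Section scaling.
Context {R : realType}.
Local Notation mu := (@lebesgue_measure R).
Local Open Scope ereal_scope.

(** Uniqueness of Lebesgue measure reduces this to half-open intervals; a negative factor reverses
    the interval and swaps its closed end. Negative factors are kept for the reflection
    [v -> - v]. *)
Lemma lebesgue_measure_scale (r : R) (A : set R) : r != 0%R -> measurable A ->
  `|r|%:E * mu (( *%R r) @^-1` A) = mu A.
Proof.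
move=> r0 mA.
have mr : measurable_fun [set: measurableTypeR R]
    (( *%R r) : measurableTypeR R -> measurableTypeR R) by exact: measurable_funM.
have -> : `|r|%:E * mu (( *%R r) @^-1` A) = mscale (NngNum (normr_ge0 r)) (pushforward mu
  (( *%R r) : measurableTypeR R -> measurableTypeR R)) A by [].
apply/esym/lebesgue_measure_unique => //= _ [[a b]] _ <-.
rewrite /mscale/= /pushforward/= lebesgue_measure_itv/=.
have [rp|rn] := ltP 0%R r.
- have -> : *%R r @^-1` `]a, b] = `](a / r)%R, (b / r)%R]%classic.
    apply/seteqP; split => x /=; rewrite !in_itv/= ltr_pdivrMr// ler_pdivlMr//;
    by rewrite [(x * r)%R]mulrC.
  rewrite lebesgue_measure_itv/= !lte_fin ltr_pM2r ?invr_gt0//.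
  case: ifPn => _; last by rewrite mule0.
  by rewrite -!EFinB -EFinM -mulrBl gtr0_norm// mulrCA mulfV// mulr1.
- have {}rn : (r < 0)%R by rewrite lt_neqAle r0.
  have -> : *%R r @^-1` `]a, b] = `[(b / r)%R, (a / r)%R[%classic.
    apply/seteqP; split => x /=; rewrite !in_itv/= ltr_ndivlMr// ler_ndivrMr//;
    by rewrite [(x * r)%R]mulrC andbC.
  rewrite lebesgue_measure_itv/= !lte_fin ltr_nM2r ?invr_lt0//.
  case: ifPn => _; last by rewrite mule0.
  rewrite -!EFinB -EFinM -mulrBl ltr0_norm// mulrCA mulNr mulfV// mulrN1.
  by rewrite opprB.
Qed.

Lemma integral_scale (r : R) (f : R -> \bar R) : r != 0%R ->
  measurable_fun [set: R] f -> (forall x, 0 <= f x) ->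
  \int[mu]_x f x = `|r|%:E * \int[mu]_x f (r * x)%R.
Proof.
move=> r0 mf f0.
have mr : measurable_fun [set: measurableTypeR R]
    (( *%R r) : measurableTypeR R -> measurableTypeR R) by exact: measurable_funM.
have := ge0_integral_pushforward mr mu measurableT mf (fun x _ => f0 x).
rewrite preimage_setT /= => <-.
have mf' : measurable_fun [set: measurableTypeR R] f by [].
etransitivity; last first.
  exact: (ge0_integral_mscale _ measurableT (NngNum (normr_ge0 r)) mf').
apply: eq_measure_integral => A mA _ /=.
by rewrite -(lebesgue_measure_scale r A).
Qed.

(* Density, with respect to N(0, 1), of the law of X / r for X ~ N(th, 1). *)
Definition scale_weight (th r x : R) : R :=
  (`|r| * expR (- (r * x - th) ^+ 2 / 2 + x ^+ 2 / 2))%R.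

Lemma scale_weight_ge0 th r x : (0 <= scale_weight th r x)%R.
Proof. by rewrite mulr_ge0// expR_ge0. Qed.

Lemma measurable_scale_weight d (T : measurableType d) th (r x : T -> R) :
  measurable_fun setT r -> measurable_fun setT x ->
  measurable_fun setT (fun t => scale_weight th (r t) (x t)).
Proof.
move=> mr mx; apply: measurable_funM; first exact: measurableT_comp.
apply: measurableT_comp => //; apply: measurable_funD.
  apply: measurable_funM => //; apply: measurableT_comp => //.
  apply: measurable_funX; apply: measurable_funB => //.
  exact: measurable_funM.
by apply: measurable_funM => //; apply: measurable_funX.
Qed.

(** Substitute [r * x] in the Lebesgue integral and divide by the density of N(0, 1). Mean and
    dilation thus become a weight over one fixed law. *)
Lemma integral_normal_scale (th r : R) (f : R -> \bar R) : r != 0%R ->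
  measurable_fun [set: R] f -> (forall x, 0 <= f x) ->
  \int[normal_prob th 1]_x f x =
  \int[normal_prob 0%R 1]_x ((scale_weight th r x)%:E * f (r * x)%R).
Proof.
move=> r0 mf f0.
have mr : measurable_fun [set: R] (fun x : R => r * x)%R by exact: measurable_funM.
have mpdf n : measurable_fun [set: R] (EFin \o normal_pdf (n : R) 1).
  by apply/measurable_EFinP; exact: measurable_normal_pdf.
have mw : measurable_fun [set: R] (EFin \o scale_weight th r).
  by apply/measurable_EFinP/measurable_scale_weight.
rewrite !integral_normal_prob//; last 2 first.
- by apply: emeasurable_funM => //; exact: (measurableT_comp mf mr).
- by move=> x; rewrite mule_ge0// lee_fin scale_weight_ge0.
rewrite (integral_scale r)//; last 2 first.
- by apply: emeasurable_funM => //; exact: mpdf.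
- by move=> x; rewrite mule_ge0// lee_fin normal_pdf_ge0.
rewrite -ge0_integralZl//; last 2 first.
- apply: emeasurable_funM; first exact: (measurableT_comp mf mr).
  exact: (measurableT_comp (mpdf th) mr).
- by move=> x; rewrite mule_ge0// lee_fin normal_pdf_ge0.
apply: eq_integral => x _.
rewrite muleCA [in RHS]muleAC -[in RHS]EFinM -EFinM muleC; congr (_%:E * _).
rewrite !normal_pdf1E /scale_weight subr0.
rewrite mulrA [in RHS]mulrACA -expRD; congr (_ * expR _)%R.
by rewrite -addrA mulNr [X in (_ + (_ + X))%R]mulNr addrN addr0.
Qed.

End scaling.

Section iterated_gaussian.
Context {R : realType}.
Local Open Scope ereal_scope.

(* Measurability of a functional of a real sequence, phrased without choosing
   a sigma-algebra on sequences: composition with any measurable family of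
   sequences is measurable. *)
Definition measurable_seqfun (f : (nat -> R) -> \bar R) :=
  forall (d : measure_display) (T : measurableType d) (X : T -> nat -> R),
    (forall i, measurable_fun setT (fun t => X t i)) ->
    measurable_fun setT (fun t => f (X t)).

Lemma measurable_upd d (T : measurableType d) (X : T -> nat -> R) n (x : T -> R) :
  (forall i, measurable_fun setT (fun t => X t i)) -> measurable_fun setT x ->
  forall i, measurable_fun setT (fun t => upd (X t) n (x t) i).
Proof. by move=> mX mx i; rewrite /upd; case: (i == n). Qed.

Lemma measurable_seqfun_upd f n x : measurable_seqfun f ->
  measurable_seqfun (fun v => f (upd v n x)).
Proof. by move=> mf d T X mX; apply: mf; exact: measurable_upd. Qed.

(** One space and one random sequence work for all [f], which gives access to Tonelli and monotone
    convergence. The last coordinate is integrated outermost, hence the new factor on the right and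
    [fubini_tonelli2]. *)
Lemma iter_gauss_repr (th : nat -> R) n :
  exists (d : measure_display) (T : measurableType d) (P : probability T R)
    (X : T -> nat -> R),
    (forall i, measurable_fun setT (fun t => X t i)) /\
    forall f, measurable_seqfun f -> (forall v, 0 <= f v) ->
      iter_gauss th n f = \int[P]_t f (X t).
Proof.
elim: n => [|n [d [T [P [X [mX IH]]]]]].
  exists _, unit, (\d_tt), (fun _ _ => 0%R); split => // f mf f0.
  by rewrite integral_dirac//= diracE in_setT mul1e.
exists _, (T * measurableTypeR R)%type, (P \x (normal_prob (th n) 1)).
exists (fun z => upd (X z.1) n z.2); split.
  apply: measurable_upd => // i.
  exact: (measurableT_comp (mX i) measurable_fst).
move=> f mf f0.
rewrite fubini_tonelli2//; last first.
  apply: mf; apply: measurable_upd => // i.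
  exact: (measurableT_comp (mX i) measurable_fst).
apply: eq_integral => x _; rewrite -/(iter_gauss th n _) IH//.
exact: measurable_seqfun_upd.
Qed.

Lemma iter_gauss_ge0 (th : nat -> R) n f : (forall v, 0 <= f v) -> 0 <= iter_gauss th n f.
Proof.
elim: n f => [|n IH] f f0 //=.
by apply: integral_ge0 => x _; exact: IH.
Qed.

(** Joint measurability of [F] is tested along measurable families, as in [measurable_seqfun]. *)
Lemma measurable_iter_gauss (th : nat -> R) n d (T : measurableType d)
    (F : T -> (nat -> R) -> \bar R) :
  (forall d' (T' : measurableType d') (a : T' -> T) (X : T' -> nat -> R),
     measurable_fun setT a -> (forall i, measurable_fun setT (fun t => X t i)) ->
     measurable_fun setT (fun t => F (a t) (X t))) ->
  (forall t v, 0 <= F t v) ->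
  measurable_fun setT (fun t => iter_gauss th n (F t)).
Proof.
move=> mF F0; have [d' [T' [P [X [mX PE]]]]] := iter_gauss_repr th n.
rewrite (_ : (fun t => _) = fubini_F P (fun z => F z.1 (X z.2))).
  apply: measurable_fun_fubini_tonelli_F => //.
  by apply: mF => // i; exact: (measurableT_comp (mX i) measurable_snd).
apply/funext => t; rewrite PE// => d'' T'' Y mY.
by apply: mF => //; exact: measurable_cst.
Qed.

Lemma iter_gauss_scale th r n (f : (nat -> R) -> \bar R) : r != 0%R ->
  measurable_seqfun f -> (forall v, 0 <= f v) ->
  iter_gauss th n f = iter_gauss (fun=> 0%R) n (fun v =>
    (\prod_(i < n) scale_weight (th i) r (v i))%:E * f (fun j => r * v j)%R).
Proof.
move=> r0; elim: n f => [|n IH] f mf f0.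
  by rewrite /= big_ord0 mul1e; congr f; apply/funext => j; rewrite mulr0.
rewrite /= (integral_normal_scale (th n) r)//; last 2 first.
- apply: measurable_iter_gauss => [d' T' a X ma mX|//].
  by apply: mf; exact: measurable_upd.
- by move=> x; exact: iter_gauss_ge0.
apply: eq_integral => x _.
rewrite IH//; last exact: measurable_seqfun_upd.
have [d [T [P [X [mX PE]]]]] := iter_gauss_repr (fun=> 0%R) n.
have mprod (d' : measure_display) (T' : measurableType d') (Y : T' -> nat -> R) m :
    (forall i, measurable_fun setT (fun t => Y t i)) ->
  measurable_fun setT (fun t => (\prod_(i < m) scale_weight (th i) r (Y t i))%:E).
  move=> mY; apply/measurable_EFinP; apply: measurable_prod => i _.
  exact: measurable_scale_weight.
have prod0 (v : nat -> R) m : (0 <= \prod_(i < m) scale_weight (th i) r (v i))%R.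
  by apply: prodr_ge0 => i _; exact: scale_weight_ge0.
have mfr y : measurable_seqfun (fun v => f (upd (fun j => r * v j)%R n y)).
  move=> d' T' Y mY; apply: mf; apply: measurable_upd => // i.
  exact: measurable_funM.
rewrite PE//; last 2 first.
- by move=> d' T' Y mY; apply: emeasurable_funM; [exact: mprod|exact: mfr].
- by move=> v; rewrite mule_ge0// lee_fin.
rewrite PE//; last 2 first.
- move=> d' T' Y mY; apply: emeasurable_funM.
    by apply: (mprod _ _ (fun t => upd (Y t) n x)); exact: measurable_upd.
  apply: (mf _ _ (fun t j => r * upd (Y t) n x j)%R) => i.
  by apply: measurable_funM => //; exact: measurable_upd.
- by move=> v; rewrite mule_ge0// lee_fin; exact: (prod0 (upd v n x)).
rewrite -ge0_integralZl//; last 3 first.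
- by apply: emeasurable_funM; [exact: mprod|exact: mfr].
- by move=> t _; rewrite mule_ge0// lee_fin.
- by rewrite lee_fin scale_weight_ge0.
apply: eq_integral => t _.
have updn : upd (X t) n x n = x by rewrite /upd eqxx.
rewrite muleA -EFinM big_ord_recr/= updn; congr (_%:E * f _).
  rewrite mulrC; congr (_ * _)%R; apply: eq_bigr => i _.
  by rewrite /upd ltn_eqF.
by apply/funext => j; rewrite /upd; case: ifP.
Qed.

End iterated_gaussian.

(** * Derivative rules for functions written pointwise *)

Section derivatives.
Set Implicit Arguments.
Unset Strict Implicit.
Context {R : realType}.
Implicit Types (f g : R -> R) (x a b : R).

Lemma is_derive1D f g x a b : is_derive x 1 f a -> is_derive x 1 g b ->
  is_derive x 1 (fun y => f y + g y) (a + b).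
Proof. exact: is_deriveD. Qed.

Lemma is_derive1M f g x a b : is_derive x 1 f a -> is_derive x 1 g b ->
  is_derive x 1 (fun y => f y * g y) (a * g x + f x * b).
Proof.
move=> fa gb; apply: is_derive_eq (is_deriveM fa gb) _.
by rewrite addrC /GRing.scale/= [g x * a]mulrC.
Qed.

Lemma is_derive1V f x a : f x != 0 -> is_derive x 1 f a -> 
  is_derive x 1 (fun y => (f y)^-1) (- a / f x ^+ 2).
Proof.
move=> fx0 fa; apply: is_derive_eq (is_deriveV fx0 fa) _.
by rewrite /GRing.scale/= mulNr mulrC mulNr.
Qed.

Lemma is_derive1X f x a n : is_derive x 1 f a ->
  is_derive x 1 (fun y => f y ^+ n) (n%:R * f x ^+ n.-1 * a).
Proof.
by move=> fa; have := is_deriveX n fa; rewrite exprfctE.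
Qed.

Lemma is_derive1_exp f x a : is_derive x 1 f a ->
  is_derive x 1 (fun y => expR (f y)) (expR (f x) * a).
Proof. by move=> fa; apply: (@is_derive1_comp _ expR). Qed.

End derivatives.

(** * Measurability of zero extensions, and the total mass of the radial kernel *)

Section real_measurability.
Set Implicit Arguments.
Unset Strict Implicit.
Context {R : realType}.

Lemma measurable_patch_open (D : set R) (f : R -> R) : open D ->
  {in D, continuous f} -> measurable_fun [set: R] (f \_ D).
Proof.
move=> oD cf; apply/(measurable_restrictT _ (open_measurable oD)).
exact: open_continuous_measurable_fun.
Qed.

Lemma measurable_invr : measurable_fun [set: R] (@GRing.inv R).
Proof.
have -> : @GRing.inv R = @GRing.inv R \_ [set~ 0].
  apply/funext => x; rewrite patchE; case: ifPn => // /negP.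
  by rewrite inE/= => /contrapT ->; rewrite invr0.
apply: measurable_patch_open.
  by apply: closed_openC; exact: closed_eq.
by move=> x; rewrite inE/= => /eqP x0; exact: inv_continuous.
Qed.

Lemma measurable_sqrtr : measurable_fun [set: R] (@Num.sqrt R).
Proof. by apply: continuous_measurable_fun; exact: sqrt_continuous. Qed.

(** The cut-off is a real factor, so that radial integrals range over the whole line, where dilation
    and Tonelli apply directly. *)
Definition posr (r : R) : R := \1_(`]0, +oo[%classic : set R) r.

Lemma posr_gt0 r : 0 < r -> posr r = 1.
Proof. by move=> r0; rewrite /posr indicE mem_set//= in_itv/= r0. Qed.

Lemma posr_le0 r : r <= 0 -> posr r = 0.
Proof.
by move=> r0; rewrite /posr indicE memNset//= in_itv/= andbT ltNge r0.
Qed.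

Lemma posr_ge0 r : 0 <= posr r.
Proof. by have [/posr_gt0->|/posr_le0->] := ltP 0 r. Qed.

Lemma measurable_posr : measurable_fun [set: R] posr.
Proof. exact: measurable_indic. Qed.

Lemma integral_posr (f : R -> R) :
  (\int[lebesgue_measure]_r (posr r * f r)%:E =
   \int[lebesgue_measure]_(r in `]0%R, +oo[) (f r)%:E)%E.
Proof.
rewrite [RHS]integral_mkcond; apply: eq_integral => r _.
rewrite patchE; case: ifPn => [|/negP]; rewrite inE/= in_itv/= andbT.
  by move=> r0; rewrite posr_gt0// mul1r.
by move=> /negP; rewrite -leNgt => r0; rewrite posr_le0// mul0r.
Qed.

(** The primitive [- q / (r^2 + q)] runs from -1 at 0 to 0 at infinity. *)
Lemma integral_radial_kernel (q : R) : 0 < q ->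
  (\int[lebesgue_measure]_r (posr r * (2 * q * r / (r ^+ 2 + q) ^+ 2))%:E = 1)%E.
Proof.
move=> q0; rewrite integral_posr.
have den x : x ^+ 2 + q != 0 by rewrite gt_eqF// ltr_wpDl// sqr_ge0.
have dF (x : R) : is_derive x (1 : R) (fun r : R => - q * (r ^+ 2 + q)^-1)
    (2 * q * x / (x ^+ 2 + q) ^+ 2).
  apply: is_derive_eq.
  by rewrite /GRing.scale/= !mulr1 addr0; field; exact: den.
have cf : continuous (fun r : R => 2 * q * r / (r ^+ 2 + q) ^+ 2).
  move=> x; apply: cvgM.
    by apply: cvgM; [exact: cvg_cst|exact: cvg_id].
  apply: cvgV; first by rewrite expf_neq0.
  apply: (@cvg_comp _ _ _ (fun r => r ^+ 2 + q) (fun y => y ^+ 2)).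
    apply: cvgD; [exact: exprn_continuous|exact: cvg_cst].
  exact: exprn_continuous.
rewrite integral_itv_obnd_cbnd; last first.
  apply/measurable_EFinP; apply: measurable_funTS.
  exact: continuous_measurable_fun.
rewrite (@ge0_continuous_FTC2y _ _ (fun r : R => - q * (r ^+ 2 + q)^-1) 0 0).
- have -> : - q / (0 ^+ 2 + q) = -1 by field; rewrite gt_eqF.
  by rewrite -EFinB opprK add0r.
- move=> x x0; rewrite divr_ge0 ?sqr_ge0// mulr_ge0//.
  by rewrite mulr_ge0// ltW.
- by apply: continuous_subspaceT.
- rewrite -[X in _ --> X](mulr0 (- q)).
  apply: cvgM; first exact: cvg_cst.
  apply/gtr0_cvgV0; first by near=> x; rewrite ltr_wpDl// sqr_ge0.
  apply/cvgryPge => A; near=> x.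
  have : A <= x ^+ 2.
    near: x; have /cvgryPge := @cvgr_expr2 R; exact.
  by move=> /le_trans; apply; rewrite lerDl ltW.
- by move=> x _; exact: ex_derive.
- apply: cvg_at_right_filter.
  apply: (@cvgM _ _ _ _ (fun=> - q)); first exact: cvg_cst.
  apply: cvgV => //; apply: cvgD; [exact: exprn_continuous|exact: cvg_cst].
- by move=> x _; rewrite derive1E; exact: derive_val.
Unshelve. all: by end_near. Qed.

End real_measurability.

(** * Polar coordinates *)

Section polar.
Set Implicit Arguments.
Unset Strict Implicit.
Context {R : realType} (p : nat).
Local Notation mu := (@lebesgue_measure R).
Implicit Types (v th : nat -> R) (r : R).

Definition sqn v : R := \sum_(i < p) v i ^+ 2.

(** At [sqn v = 0] the convention [0^-1 = 0] yields the zero vector instead of a unit vector;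
    [angular_weight] vanishes there. *)
Definition direction v (j : nat) : R := (Num.sqrt (sqn v))^-1 * v j.

(** The Gaussian exponential on the ray through [v], times the polar Jacobian [r^(p-1)]; normalising
    constants are left to the angular factor. *)
Definition radial_weight th v r : R :=
  posr r * (r ^+ p.-1 * expR (- (\sum_(i < p) (r * v i - th i) ^+ 2) / 2)).

Definition radial_kernel v r : R :=
  posr r * (2 * sqn v * r / (r ^+ 2 + sqn v) ^+ 2).

(** With [q = sqn v], the fraction is [radial_kernel v 1], and [expR (q / 2)] undoes the exponent of
    the standard Gaussian density at [v]. *)
Definition angular_base v : R :=
  2 * sqn v / (1 + sqn v) ^+ 2 * expR (sqn v / 2).

(** The power of the inverse norm is the Jacobian of reparametrising the ray through [v] by a unit
    vector. *)
Definition angular_weight v : R :=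
  angular_base v * (Num.sqrt (sqn v))^-1 ^+ p.

Lemma sqn_ge0 v : 0 <= sqn v.
Proof. by apply: sumr_ge0 => i _; exact: sqr_ge0. Qed.

Lemma sqnZ r v : sqn (fun j => r * v j) = r ^+ 2 * sqn v.
Proof. by rewrite /sqn mulr_sumr; apply: eq_bigr => i _; rewrite exprMn. Qed.

Lemma sqnN v : sqn (fun j => - v j) = sqn v.
Proof. by apply: eq_bigr => i _; rewrite sqrrN. Qed.

Lemma sqn_direction v : 0 < sqn v -> sqn (direction v) = 1.
Proof.
move=> q0; rewrite /direction sqnZ exprVn sqr_sqrtr ?sqn_ge0// mulVf//.
by rewrite gt_eqF.
Qed.

Lemma radial_weight_ge0 th v r : 0 <= radial_weight th v r.
Proof.
rewrite /radial_weight; have [r0|r0] := ltP 0 r.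
  by rewrite mulr_ge0 ?posr_ge0// mulr_ge0 ?expR_ge0// exprn_ge0// ltW.
by rewrite posr_le0// mul0r.
Qed.

Lemma radial_kernel_ge0 v r : 0 <= radial_kernel v r.
Proof.
rewrite /radial_kernel; have [r0|r0] := ltP 0 r; last by rewrite posr_le0// mul0r.
rewrite mulr_ge0 ?posr_ge0// divr_ge0 ?sqr_ge0// !mulr_ge0 ?sqn_ge0//.
exact: ltW.
Qed.

Lemma angular_base_ge0 v : 0 <= angular_base v.
Proof.
by rewrite !mulr_ge0 ?expR_ge0 ?invr_ge0 ?sqr_ge0 ?sqn_ge0.
Qed.

Lemma angular_weight_ge0 v : 0 <= angular_weight v.
Proof. by rewrite mulr_ge0 ?angular_base_ge0// exprn_ge0// invr_ge0 sqrtr_ge0. Qed.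

Section measurability.
Context d (T : measurableType d) (X : T -> nat -> R) (r : T -> R).
Hypothesis mX : forall i, measurable_fun setT (fun t => X t i).
Hypothesis mr : measurable_fun setT r.

Lemma measurable_sqn : measurable_fun setT (fun t => sqn (X t)).
Proof. by apply: measurable_sum => i; exact: measurable_funX. Qed.

Lemma measurable_invf (g : T -> R) : measurable_fun setT g ->
  measurable_fun setT (fun t => (g t)^-1).
Proof. exact: (measurableT_comp measurable_invr). Qed.

Lemma measurable_direction i : measurable_fun setT (fun t => direction (X t) i).
Proof.
apply: measurable_funM => //; apply: measurable_invf.
exact: (measurableT_comp measurable_sqrtr measurable_sqn).
Qed.

Lemma measurable_expf (g : T -> R) : measurable_fun setT g ->
  measurable_fun setT (fun t => expR (g t)).
Proof. exact: (measurableT_comp (@measurable_expR R)). Qed.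

Lemma measurable_radial_weight th :
  measurable_fun setT (fun t => radial_weight th (X t) (r t)).
Proof.
apply: measurable_funM; first exact: (measurableT_comp measurable_posr mr).
apply: measurable_funM; first exact: measurable_funX.
apply: measurable_expf; apply: measurable_funM => //; apply: measurable_funN.
apply: measurable_sum => i; apply: measurable_funX; apply: measurable_funB => //.
exact: measurable_funM.
Qed.

Lemma measurable_radial_kernel :
  measurable_fun setT (fun t => radial_kernel (X t) (r t)).
Proof.
apply: measurable_funM; first exact: (measurableT_comp measurable_posr mr).
apply: measurable_funM.
  apply: measurable_funM => //; apply: measurable_funM => //.
  exact: measurable_sqn.
apply: measurable_invf; apply: measurable_funX; apply: measurable_funD.
  exact: measurable_funX.
exact: measurable_sqn.
Qed.

Lemma measurable_angular_base : measurable_fun setT (fun t => angular_base (X t)).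
Proof.
have mq := measurable_sqn.
apply: measurable_funM.
  apply: measurable_funM; first exact: measurable_funM.
  apply: measurable_invf; apply: measurable_funX; exact: measurable_funD.
by apply: measurable_expf; exact: measurable_funM.
Qed.

Lemma measurable_angular_weight :
  measurable_fun setT (fun t => angular_weight (X t)).
Proof.
apply: measurable_funM; first exact: measurable_angular_base.
apply: measurable_funX; apply: measurable_invf.
exact: (measurableT_comp measurable_sqrtr measurable_sqn).
Qed.

End measurability.

Lemma prod_scale_weight th v r : 0 < r ->
  \prod_(i < p) scale_weight (th i) r (v i) =
  r ^+ p * expR (- (\sum_(i < p) (r * v i - th i) ^+ 2) / 2 + sqn v / 2).
Proof.
move=> r0; rewrite big_split/= prodr_const card_ord gtr0_norm//; congr (_ * _).
rewrite -expR_sum; congr expR.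
rewrite big_split/= /sqn -sumrN !mulr_suml; congr (_ + _).
Qed.

(** The kernel is homogeneous of degree -1: at [(r v, r)] it is [r^-1] times its value at [(v, 1)].
    This lowers the Jacobian [r^p] of the dilation to the polar [r^(p-1)]. *)
Lemma radial_kernel_scale th v r : (0 < p)%N ->
  0 < r ->
  (\prod_(i < p) scale_weight (th i) r (v i)) * radial_kernel (fun j => r * v j) r =
  angular_base v * radial_weight th v r.
Proof.
move=> p0 r0; rewrite prod_scale_weight// /radial_kernel /angular_base /radial_weight.
have -> : r ^+ p = r * r ^+ p.-1 by rewrite -exprS prednK.
rewrite sqnZ posr_gt0// !mul1r expRD.
have q0 := sqn_ge0 v; have d0 : 1 + sqn v != 0 by rewrite gt_eqF// ltr_wpDr.
have d1 : r ^+ 2 + r ^+ 2 * sqn v != 0.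
  by rewrite -[X in X + _]mulr1 -mulrDr mulf_neq0// expf_neq0// gt_eqF.
set E1 := expR _; set E2 := expR _; set rp := r ^+ p.-1; set q := sqn v.
by field; rewrite d0 d1.
Qed.

End polar.

Section polar_formula.
Set Implicit Arguments.
Unset Strict Implicit.
Context {R : realType} (p : nat).
Local Notation mu := (@lebesgue_measure R).
Local Open Scope ereal_scope.

(** It is enough to inspect the outermost coordinate: if it is nonzero then [sqn] is positive, and
    the singleton 0 is null for a normal law. *)
Lemma iter_gauss_sqn0 (th : nat -> R) (f g : (nat -> R) -> \bar R) : (0 < p)%N ->
  measurable_seqfun f -> (forall v, 0 <= f v) ->
  measurable_seqfun g -> (forall v, 0 <= g v) ->
  (forall v, (0 < sqn p v)%R -> f v = g v) ->
  iter_gauss th p f = iter_gauss th p g.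
Proof.
case: p => // n _ mf f0 mg g0 fg /=.
have m h : measurable_seqfun h -> (forall v, 0 <= h v) ->
    measurable_fun [set: R] (fun x => iter_gauss th n (fun v => h (upd v n x))).
  move=> mh h0; apply: measurable_iter_gauss => // d' T' a X ma mX.
  by apply: mh; exact: measurable_upd.
apply: ge0_ae_eq_integral => //; try exact: m.
- by move=> x _; exact: iter_gauss_ge0.
- by move=> x _; exact: iter_gauss_ge0.
exists [set 0%R]; split => //.
  by rewrite /= /normal_prob integral_set1.
move=> x/=; apply: contra_notP => /eqP x0 _.
congr iter_gauss; apply/funext => v; apply: fg.
rewrite /sqn big_ord_recr/= {2}/upd eqxx ltr_wpDl//.
  by apply: sumr_ge0 => i _; exact: sqr_ge0.
by rewrite exprn_even_gt0.
Qed.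

Lemma measurable_ray_integrand (th s : nat -> R) f : measurable_seqfun f ->
  measurable_fun [set: R] (fun r => (radial_weight p th s r)%:E *
    f (fun j => r * s j)%R).
Proof.
move=> mf; apply: emeasurable_funM.
  apply/measurable_EFinP.
  exact: (@measurable_radial_weight _ _ _ _ (fun=> s) id).
apply: (mf _ _ (fun (r : R) j => r * s j)%R) => i; exact: measurable_funM.
Qed.

(** Substitute [c * r] with [c = |v|^-1]: [dr] contributes one factor [c] and [r^(p-1)] the other
    [p - 1]. *)
Lemma integral_ray_direction (th v : nat -> R) (f : (nat -> R) -> \bar R) :
  (0 < p)%N -> (0 < sqn p v)%R -> measurable_seqfun f -> (forall v, 0 <= f v) ->
  \int[mu]_r ((radial_weight p th v r)%:E * f (fun j => r * v j)%R) =
  ((Num.sqrt (sqn p v))^-1 ^+ p)%:E * \int[mu]_r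
    ((radial_weight p th (direction p v) r)%:E *
      f (fun j => r * direction p v j)%R).
Proof.
move=> p0 q0 mf f0; set c := (Num.sqrt (sqn p v))^-1%R.
have c0 : (0 < c)%R by rewrite invr_gt0 sqrtr_gt0.
have G0 s r : 0 <= (radial_weight p th s r)%:E * f (fun j => r * s j)%R.
  by rewrite mule_ge0// lee_fin radial_weight_ge0.
rewrite (@integral_scale _ c (fun r => (radial_weight p th v r)%:E *
  f (fun j => r * v j)%R)); first last.
- by [].
- exact: measurable_ray_integrand.
- by rewrite gt_eqF.
have -> : (c ^+ p = c * c ^+ p.-1)%R by rewrite -exprS prednK.
rewrite (EFinM c) -muleA gtr0_norm//; congr (_ * _).
rewrite -ge0_integralZl; first last.
- by rewrite lee_fin exprn_ge0// ltW.
- by move=> r _; exact: G0.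
- exact: measurable_ray_integrand.
- exact: measurableT.
apply: eq_integral => r _; rewrite muleA -EFinM; congr (_%:E * f _).
  rewrite /radial_weight; have [r0|r0] := ltP 0%R r; last first.
    by rewrite !posr_le0// ?mul0r ?mulr0// mulr_ge0_le0// ltW.
  rewrite !posr_gt0 ?mulr_gt0// !mul1r exprMn [RHS]mulrA.
  suff -> : (\sum_(i < p) (c * r * v i - th i) ^+ 2 =
    \sum_(i < p) (r * direction p v i - th i) ^+ 2)%R by [].
  by apply: eq_bigr => i _; rewrite /direction -/c mulrA [(r * c)%R]mulrC.
by apply/funext => j; rewrite /direction -/c mulrA [(r * c)%R]mulrC.
Qed.

Context d (T : measurableType d) (P : probability T R) (Z : T -> nat -> R).
Hypothesis mZ : forall i, measurable_fun setT (fun t => Z t i).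
Hypothesis PZ : forall f, measurable_seqfun f -> (forall v, 0 <= f v) ->
  iter_gauss (fun=> 0%R) p f = \int[P]_t f (Z t).

(* Polar coordinates without a measure on the sphere: insert the kernel
   [radial_kernel], which has total radial mass 1 and is invariant under joint
   dilation, integrate over the dilation parameter and rescale the Gaussian. *)
Lemma polar_formula (th : nat -> R) (f : (nat -> R) -> \bar R) : (0 < p)%N ->
  measurable_seqfun f -> (forall v, 0 <= f v) ->
  iter_gauss th p f =
  \int[P]_t ((angular_weight p (Z t))%:E * \int[mu]_r
    ((radial_weight p th (direction p (Z t)) r)%:E
       * f (fun j => r * direction p (Z t) j)%R)).
Proof.
move=> p0 mf f0.
have [d' [T' [Q [Y [mY QY]]]]] := iter_gauss_repr th p.
have mfr (d1 : measure_display) (T1 : measurableType d1) (r : T1 -> R)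
    (X : T1 -> nat -> R) :
    measurable_fun setT r -> (forall i, measurable_fun setT (fun t => X t i)) ->
    measurable_fun setT (fun t => f (fun j => r t * X t j)%R).
  move=> mr mX; apply: (mf _ _ (fun t j => r t * X t j)%R) => i.
  exact: measurable_funM.
have mkf r : measurable_seqfun (fun v => (radial_kernel p v r)%:E * f v).
  move=> d1 T1 X mX; apply: emeasurable_funM; last exact: mf.
  by apply/measurable_EFinP; exact: measurable_radial_kernel.
have kf0 r v : 0 <= (radial_kernel p v r)%:E * f v.
  by rewrite mule_ge0// lee_fin radial_kernel_ge0.
(* [Y] has mean [th] and [Z] has mean 0. The kernel integrates to 1 except where [sqn] is 0, a null
   set. *)
transitivity (\int[Q]_t \int[mu]_r ((radial_kernel p (Y t) r)%:E * f (Y t))).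
  transitivity (\int[Q]_t ((\int[mu]_r (radial_kernel p (Y t) r)%:E) * f (Y t)));
    last first.
    apply: eq_integral => t _; rewrite ge0_integralZr//.
      by apply/measurable_EFinP; exact: measurable_radial_kernel.
    by move=> r _; rewrite lee_fin radial_kernel_ge0.
  have mk (d1 : measure_display) (T1 : measurableType d1) (X : T1 -> nat -> R) :
      (forall i, measurable_fun setT (fun t => X t i)) ->
      measurable_fun setT (fun t => \int[mu]_r (radial_kernel p (X t) r)%:E).
    move=> mX.
    apply: (@measurable_fun_fubini_tonelli_F _ _ _ (measurableTypeR R) _ mu
      (fun z => (radial_kernel p (X z.1) z.2)%:E)).
      apply/measurable_EFinP.
      apply: (@measurable_radial_kernel _ _ _ _ (fun z => X z.1) snd) => // i.
      exact: (measurableT_comp (mX i) measurable_fst).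
    by move=> z; rewrite lee_fin radial_kernel_ge0.
  rewrite -(QY (fun v => (\int[mu]_r (radial_kernel p v r)%:E) * f v)).
  - apply: iter_gauss_sqn0 => //.
    + move=> d1 T1 X mX; apply: emeasurable_funM; [exact: mk|exact: mf].
    + move=> v; rewrite mule_ge0// integral_ge0// => r _.
      by rewrite lee_fin radial_kernel_ge0.
    + by move=> v q0; rewrite integral_radial_kernel// mul1e.
  - move=> d1 T1 X mX; apply: emeasurable_funM; [exact: mk|exact: mf].
  - move=> v; rewrite mule_ge0// integral_ge0// => r _.
    by rewrite lee_fin radial_kernel_ge0.
rewrite (@fubini_tonelli _ _ _ (measurableTypeR R) _ Q mu
  (fun z => (radial_kernel p (Y z.1) z.2)%:E * f (Y z.1)))//=; last first.
  have mY1 i : measurable_fun setT (fun z : T' * measurableTypeR R => Y z.1 i).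
    exact: (measurableT_comp (mY i) measurable_fst).
  apply: emeasurable_funM; last exact: mf.
  apply/measurable_EFinP.
  by apply: (@measurable_radial_kernel _ _ _ _ (fun z => Y z.1) snd).
(* For fixed [r > 0] the Gaussian is dilated by this very [r], which moves all dependence on [th]
   into weights over [Z]; for [r <= 0] both sides vanish. *)
transitivity (\int[mu]_r \int[P]_t ((angular_base p (Z t))%:E *
    ((radial_weight p th (Z t) r)%:E * f (fun j => r * Z t j)%R))).
  apply: eq_integral => r _.
  rewrite -(QY (fun v => (radial_kernel p v r)%:E * f v))//.
  have [r0|r0] := ltP 0%R r; last first.
    have [d1 [T1 [P1 [X [mX PX]]]]] := iter_gauss_repr th p.
    rewrite PX// !integral0_eq// => t _.
      by rewrite /radial_weight posr_le0// mul0r mul0e mule0.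
    by rewrite /radial_kernel posr_le0// mul0r mul0e.
  rewrite (iter_gauss_scale _ r)// ?gt_eqF// PZ; last 2 first.
  - move=> d1 T1 X mX; apply: emeasurable_funM.
      apply/measurable_EFinP; apply: measurable_prod => i _.
      exact: measurable_scale_weight.
    apply: (mkf r _ _ (fun t j => r * X t j)%R) => i; exact: measurable_funM.
  - move=> v; rewrite mule_ge0// lee_fin; apply: prodr_ge0 => i _.
    exact: scale_weight_ge0.
  apply: eq_integral => t _.
  by rewrite !muleA -!EFinM radial_kernel_scale.
have mZ2 i : measurable_fun setT (fun z : measurableTypeR R * T => Z z.2 i).
  exact: (measurableT_comp (mZ i) measurable_snd).
rewrite (@fubini_tonelli _ _ (measurableTypeR R) _ _ mu P
  (fun z => (angular_base p (Z z.2))%:E *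
    ((radial_weight p th (Z z.2) z.1)%:E * f (fun j => z.1 * Z z.2 j)%R)))//=;
  last 2 first.
- apply: emeasurable_funM.
    apply/measurable_EFinP.
    exact: (@measurable_angular_base _ _ _ _ (fun z => Z z.2)).
  apply: emeasurable_funM; last exact: mfr.
  apply/measurable_EFinP.
  exact: (@measurable_radial_weight _ _ _ _ (fun z => Z z.2) fst).
- move=> z; rewrite mule_ge0// ?lee_fin ?angular_base_ge0//.
  by rewrite mule_ge0// lee_fin radial_weight_ge0.
apply: eq_integral => t _.
rewrite ge0_integralZl; first last.
- by rewrite lee_fin angular_base_ge0.
- by move=> r _; rewrite mule_ge0// lee_fin radial_weight_ge0.
- exact: measurable_ray_integrand.
- exact: measurableT.
rewrite /angular_weight (EFinM (angular_base p (Z t))) -muleA.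
have [q0|q0] := ltP 0%R (sqn p (Z t)); first by rewrite integral_ray_direction.
suff -> : angular_base p (Z t) = 0%R by rewrite !mul0e.
have q00 : sqn p (Z t) = 0%R by apply/eqP; rewrite eq_le q0 sqn_ge0.
by rewrite /angular_base q00 mulr0 !mul0r.
Qed.

End polar_formula.

(** * Stein's identity on rays *)

Section half_line.
Set Implicit Arguments.
Unset Strict Implicit.
Context {R : realType}.
Local Notation mu := (@lebesgue_measure R).

Lemma half_line_exhaustion :
  `]0%R, +oo[%classic = \bigcup_n `[n.+1%:R^-1 : R, n.+2%:R]%classic.
Proof.
apply/seteqP; split => [x|x [n _]]/=; rewrite !in_itv/=.
  rewrite andbT => x0.
  have [n nx] : exists n : nat, x <= n%:R.
    by exists (Num.truncn x).+1; rewrite ltW// truncnS_gt.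
  have [k kx] : exists k : nat, x^-1 <= k%:R.
    by exists (Num.truncn x^-1).+1; rewrite ltW// truncnS_gt.
  exists (maxn n k) => //=; rewrite in_itv/=; apply/andP; split.
    rewrite invf_ple ?posrE//; apply: (le_trans kx).
    by rewrite ler_nat (leq_trans (leq_maxr n k)).
  apply: (le_trans nx).
  by rewrite ler_nat (leq_trans (leq_maxl n k))// ltnW.
by move=> /andP[+ _]; rewrite andbT; apply: lt_le_trans; rewrite invr_gt0.
Qed.

(** Both integrals may be infinite, so the fundamental theorem is applied on compact intervals only
    and rearranged as a sum. Monotone convergence handles the integrals while the boundary terms
    tend to 0. *)
Lemma integral_balance (u v H : R -> R) :
  (forall r, 0 < r -> 0 <= u r) -> (forall r, 0 < r -> 0 <= v r) ->
  (forall r, 0 < r -> {for r, continuous u}) ->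
  (forall r, 0 < r -> {for r, continuous v}) ->
  (forall r : R, 0 < r -> is_derive r 1 H (v r - u r)) ->
  H x @[x --> 0^'+] --> 0 -> H x @[x --> +oo] --> 0 ->
  (\int[mu]_(r in `]0%R, +oo[) (u r)%:E = \int[mu]_(r in `]0%R, +oo[) (v r)%:E)%E.
Proof.
move=> u0 v0 cu cv dH H0 Hoo.
(* The shift to [n.+2] keeps the left end strictly below the right one at [n = 0], as
   [continuous_FTC2] requires. *)
pose F n : set R := `[n.+1%:R^-1 : R, n.+2%:R]%classic.
have Fpos n r : F n r -> 0 < r.
  by rewrite /F/= in_itv/= => /andP[+ _]; apply: lt_le_trans; rewrite invr_gt0.
have ndF : nondecreasing_seq F.
  apply/nondecreasing_seqP => n; rewrite subsetEset => x; rewrite /F/= !in_itv/=.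
  move=> /andP[h1 h2]; apply/andP; split.
    by apply: le_trans h1; rewrite lef_pV2 ?posrE// ler_nat.
  by apply: (le_trans h2); rewrite ler_nat.
have mF n : measurable (F n) by exact: measurable_itv.
have cF n (g : R -> R) : (forall r, 0 < r -> {for r, continuous g}) ->
    {within F n, continuous g}.
  move=> cg; apply: continuous_in_subspaceT => x /[!inE] /Fpos; exact: cg.
have iF n (g : R -> R) : (forall r, 0 < r -> {for r, continuous g}) ->
    mu.-integrable (F n) (EFin \o g).
  move=> cg; apply: continuous_compact_integrable; first exact: segment_compact.
  exact: cF.
have cvgF (g : R -> R) : (forall r, 0 < r -> 0 <= g r) ->
    (forall r, 0 < r -> {for r, continuous g}) ->
    (\int[mu]_(r in F i) (g r)%:E)%E @[i --> \oo] -->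
    (\int[mu]_(r in `]0%R, +oo[) (g r)%:E)%E.
  move=> g0 cg; rewrite half_line_exhaustion.
  apply: ge0_nondecreasing_set_cvg_integral => //.
    by move=> i; exact: (measurable_int mu (iF i g cg)).
  by move=> i x /Fpos; rewrite lee_fin; exact: g0.
have key n : (\int[mu]_(r in F n) (v r)%:E = \int[mu]_(r in F n) (u r)%:E +
    (H n.+2%:R - H n.+1%:R^-1)%:E)%E.
  have -> : ((H n.+2%:R - H n.+1%:R^-1)%:E =
      \int[mu]_(r in F n) (v r - u r)%:E)%E.
    rewrite (@continuous_FTC2 _ (fun r => v r - u r) H) ?EFinB//.
    - apply: (@le_lt_trans _ _ 1); first by rewrite invf_le1// ler1n.
      by rewrite ltr1n.
    - apply: (cF n) => r r0; apply: cvgB; [exact: cv|exact: cu].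
    - have cH (x : R) : 0 < x -> {for x, continuous H}.
        move=> x0; apply: differentiable_continuous; apply/derivable1_diffP.
        exact: (@ex_derive _ _ _ _ _ _ _ (dH x x0)).
      split.
      + move=> x; rewrite in_itv/= => /andP[x0 _].
        apply: (@ex_derive _ _ _ _ _ _ _ (dH x _)).
        by apply: lt_trans x0; rewrite invr_gt0.
      + by apply: cvg_at_right_filter; apply: cH; rewrite invr_gt0.
      + by apply: cvg_at_left_filter; apply: cH.
    - move=> x; rewrite in_itv/= => /andP[x0 _]; rewrite derive1E.
      apply: (@derive_val _ _ _ _ _ _ _ (dH x _)).
      by apply: lt_trans x0; rewrite invr_gt0.
  rewrite -integralD//; first last.
  - have := iF n (fun r => v r - u r); apply => r r0.
    by apply: cvgB; [exact: cv|exact: cu].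
  - exact: iF.
  - exact: mF.
  by apply: eq_integral => r _; rewrite -EFinD addrC subrK.
have Hn : (H n.+2%:R - H n.+1%:R^-1)%:E @[n --> \oo] --> (0 : \bar R).
  apply: cvg_EFin; first by near=> n.
  rewrite -[X in _ --> X](subr0 0); apply: cvgB.
    have h2 : (n.+2%:R : R) @[n --> \oo] --> +oo.
      apply/cvgryPge => A; exists (Num.truncn A).+1 => // n /= An.
      rewrite ltW// (lt_le_trans (truncnS_gt A))// ler_nat.
      by rewrite (leq_trans An)// (leq_trans (leqnSn _)).
    exact: (cvg_comp _ _ h2 Hoo).
  apply: (cvg_at_rightP _ _ _).1 H0 _ _; split.
    by move=> n; rewrite invr_gt0.
  exact: cvg_harmonic.
have L : (\int[mu]_(r in F n) (u r)%:E + (H n.+2%:R - H n.+1%:R^-1)%:E)%E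
   @[n --> \oo] --> (\int[mu]_(r in `]0%R, +oo[) (u r)%:E)%E.
  rewrite -[X in _ --> X]adde0; apply: cvgeD => //; last exact: cvgF.
  by rewrite fin_num_adde_defl.
have Lv := cvgF v v0 cv; rewrite (funext key) in Lv.
exact: (cvg_unique _ L Lv).
Unshelve. all: by end_near. Qed.

End half_line.

(** * Continuity of a derivative, and exponential bounds *)

Section monotone_derivative.
Set Implicit Arguments.
Unset Strict Implicit.
Context {R : realType}.
Local Notation mu := (@lebesgue_measure R).

Lemma is_derive1_continuous (f : R -> R) (x a : R) : is_derive x 1 f a ->
  {for x, continuous f}.
Proof.
move=> fa; apply: differentiable_continuous; apply/derivable1_diffP.
exact: (@ex_derive _ _ _ _ _ _ _ fa).
Qed.

(* A derivative has the intermediate value property, so it cannot jump; the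
   mean value theorem makes this quantitative. *)
Lemma continuous_monotone_derivative (G g : R -> R) :
  (forall w : R, 0 < w -> is_derive w 1 G (g w)) ->
  (forall w : R, 0 < w -> 0 <= g w) ->
  (forall w1 w2 : R, 0 < w1 -> w1 <= w2 -> w1 * g w1 <= w2 * g w2) ->
  forall w : R, 0 < w -> {for w, continuous g}.
Proof.
move=> dG g0 mono w w0.
have cG (x : R) : 0 < x -> {for x, continuous G}.
  by move=> x0; exact: is_derive1_continuous (dG x x0).
have mvt (x y : R) : 0 < x -> x < y -> exists2 c, x < c < y & G y - G x = g c * (y - x).
  move=> x0 xy; have [||c] := @MVT _ G g x y xy.
  - by move=> z; rewrite in_itv/= => /andP[xz _]; apply: dG; exact: lt_trans xz.
  - apply: continuous_in_subspaceT => z; rewrite inE/= in_itv/= => /andP[xz _].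
    by apply: cG; exact: lt_le_trans xz.
  - by rewrite in_itv/= => ?; exists c.
(* The factor [w + h] prepares the comparison with [x * g x], the function that is monotone. *)
have qcvg : (w + h) * (h^-1 * (G (h + w) - G w)) @[h --> 0^'] --> w * g w.
  apply: cvgM.
    rewrite -[X in _ --> X]addr0; apply: cvgD; first exact: cvg_cst.
    by apply: cvg_within_filter; exact: cvg_id.
  have [dGw <-] := dG w w0.
  have := dGw => /cvg_ex [l Gl].
  rewrite /derive (cvg_lim _ Gl)//.
  have -> : (fun h => h^-1 * (G (h + w) - G w)) =
      (fun h => h^-1 *: ((G \o shift w) (h *: 1) - G w)).
    by apply/funext => h /=; rewrite /GRing.scale/= mulr1.
  exact: Gl.
suff ch : {for w, continuous (fun x : R => x * g x)}.
  have E : \near w, (fun x : R => x^-1 * (x * g x)) w = g w.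
    near=> x; rewrite mulKf// gt_eqF//; near: x; exact: lt_nbhsr.
  have H : (x^-1 * (x * g x) : R) @[x --> w] --> g w.
    rewrite -[X in _ --> X](@mulKf _ w) ?gt_eqF//.
    exact: cvgM (@inv_continuous _ w (lt0r_neq0 w0)) ch.
  exact: (cvg_trans (near_eq_cvg E) H).
apply/cvgrPdist_lt => e e0.
have /cvgrPdist_lt /(_ e e0) := qcvg.
rewrite /dnbhs /within/= => -[d/= d0 dP].
(* Small enough for the difference quotients at [h] and [- h], and for [w - h] to stay positive. *)
pose h := Num.min (d / 2) (w / 2).
have h0 : 0 < h by rewrite lt_min !divr_gt0.
have hd : h < d by rewrite gt_min; apply/orP; left; lra.
have hw : h < w by rewrite gt_min; apply/orP; right; lra.
have [c1 /andP[c1l c1u] G1] := mvt w (w + h) w0 ltac:(lra).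
have [c2 /andP[c2l c2u] G2] := mvt (w - h) w ltac:(lra) ltac:(lra).
have P1 : w * g w + e > (w + h) * g c1.
  have := dP h; rewrite /= sub0r normrN gtr0_norm// => /(_ hd (lt0r_neq0 h0)).
  have -> : h^-1 * (G (h + w) - G w) = g c1.
    by rewrite [h + w]addrC G1; field; rewrite gt_eqF.
  by rewrite ltr_norml => /andP[+ _]; lra.
have P2 : w * g w - e < (w - h) * g c2.
  have := dP (- h); rewrite /= opprK add0r gtr0_norm// oppr_eq0.
  move=> /(_ hd (lt0r_neq0 h0)).
  have -> : (- h)^-1 * (G (- h + w) - G w) = g c2.
    by rewrite [- h + w]addrC -[G (w - h) - G w]opprB G2; field; rewrite gt_eqF.
  by rewrite ltr_norml => /andP[_ +]; lra.
have c10 : 0 < c1 by lra.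
have c20 : 0 < c2 by lra.
near=> x.
have xl : c2 < x by near: x; exact: lt_nbhsr.
have xu : x < c1 by near: x; exact: lt_nbhsl.
(* Between the two mean value points, monotonicity squeezes [x * g x] between [(w - h) * g c2] and
   [(w + h) * g c1], both within [e] of [w * g w]. *)
have m1 := mono x c1 ltac:(lra) ltac:(lra).
have m2 := mono c2 x c20 ltac:(lra).
have n1 : c1 * g c1 <= (w + h) * g c1 by rewrite ler_wpM2r ?g0// ltW.
have n2 : (w - h) * g c2 <= c2 * g c2 by rewrite ler_wpM2r ?g0// ltW.
rewrite ltr_norml; apply/andP; split; lra.
Unshelve. all: by end_near. Qed.

(** Use [r^n <= n! e^r], then complete the squares of [r - a - 2] and [a - 1], which produces the
    constant 3. The bound is free of [a], hence uniform over directions. *)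
Lemma pow_gauss_le n (r a b : R) : 0 <= r -> a ^+ 2 <= b ->
  r ^+ n * expR (- (r ^+ 2 - 2 * r * a + b) / 2) <=
  n`!%:R * expR (b + 3) * expR (- r).
Proof.
move=> r0 ab.
have rn : r ^+ n <= n`!%:R * expR r.
  case: n => [|n]; first by rewrite expr0 fact0 mul1r -expR0 ler_expR.
  have f0 : 0 < n.+1`!%:R :> R by rewrite ltr0n fact_gt0.
  rewrite -ler_pdivrMl// mulrC.
  by apply: le_trans (expR_ge1Dxn n r0); rewrite lerDr.
apply: (le_trans (ler_wpM2r (expR_ge0 _) rn)).
rewrite -!mulrA ler_wpM2l// -!expRD ler_expR.
have := sqr_ge0 (r - a - 2); have := sqr_ge0 (a - 1).
rewrite !expr2 in ab *; nra.
Qed.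

Lemma integral_exp_half_line :
  (\int[mu]_r (posr r * expR (- r))%:E < +oo)%E.
Proof.
rewrite integral_posr.
have cf : continuous (fun r : R => expR (- r)).
  move=> x; apply: (@cvg_comp _ _ _ (fun r : R => - r) expR).
    by apply: cvgN; exact: cvg_id.
  exact: continuous_expR.
rewrite integral_itv_obnd_cbnd; last first.
  apply/measurable_EFinP; apply: measurable_funTS.
  exact: continuous_measurable_fun.
have dF (x : R) : is_derive x 1 (fun r : R => - expR (- r)) (expR (- x)).
  by apply: is_derive_eq; rewrite /GRing.scale/= mulrN1 opprK.
rewrite (@ge0_continuous_FTC2y _ _ (fun r : R => - expR (- r)) 0 0).
- by rewrite -EFinB ltry.
- by move=> x _; exact: expR_ge0.
- exact: continuous_subspaceT.
- by rewrite -oppr0; apply: cvgN; exact: cvgr_expR.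
- by move=> x _; exact: ex_derive.
- apply: cvg_at_right_filter; apply: cvgN; exact: cf.
- by move=> x _; rewrite derive1E; exact: derive_val.
Qed.

End monotone_derivative.

(** * The gain and Stein's identity on a ray, with [p = n.+3] and [c = p - 2] *)

Section risk_gain.
Set Implicit Arguments.
Unset Strict Implicit.
Context {R : realType} (n : nat) (phi : R -> R).
Local Notation mu := (@lebesgue_measure R).
Local Notation c := (n.+1%:R : R).

Hypothesis dphi : forall w : R, 0 < w -> derivable phi w 1.
Hypothesis phi_lt : forall w : R, 0 < w -> phi w < c.
Hypothesis dphi_ge0 : forall w : R, 0 < w -> 0 <= derive1 phi w.
Hypothesis phi_ge0 : forall w : R, 0 <= w -> 0 <= phi w.
Hypothesis mono : forall w1 w2 : R, 0 < w1 -> w1 <= w2 ->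
  w1 * derive1 phi w1 / (c - phi w1) ^+ 2 <= w2 * derive1 phi w2 / (c - phi w2) ^+ 2.

(* Stein's unbiased estimate of the risk difference between the James-Stein
   estimator and the estimator given by phi, as a function of |X|^2. *)
Definition gain (w : R) : R := 4 * derive1 phi w - (c - phi w) ^+ 2 / w.
(** Positive and negative parts are separated so that each has an expectation in the extended reals
    without any integrability. *)
Definition gainp (w : R) : R := (`|gain w| + gain w) / 2.
Definition gainn (w : R) : R := (`|gain w| - gain w) / 2.

Lemma gainp_ge0 w : 0 <= gainp w.
Proof. by rewrite divr_ge0//; have := ler_norm (- gain w); rewrite normrN; lra. Qed.

Lemma gainn_ge0 w : 0 <= gainn w.
Proof. by rewrite divr_ge0//; have := ler_norm (gain w); lra. Qed.

Lemma gainpnB w : gainp w - gainn w = gain w.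
Proof. by rewrite /gainp /gainn; field. Qed.

Lemma gainp_eq0 w : gain w <= 0 -> gainp w = 0.
Proof. by move=> g0; rewrite /gainp ler0_norm// addNr mul0r. Qed.

Lemma gainn_eq0 w : 0 <= gain w -> gainn w = 0.
Proof. by move=> g0; rewrite /gainn ger0_norm// subrr mul0r. Qed.

(** Since [phi' >= 0], the negative part comes only from [(c - phi)^2 / w], and
    [0 <= c - phi <= c]. *)
Lemma gainn_le w : 0 < w -> gainn w <= c ^+ 2 / w.
Proof.
move=> w0; have pw := phi_lt w0; have p0 := phi_ge0 (ltW w0).
have sq : (c - phi w) ^+ 2 / w <= c ^+ 2 / w.
  rewrite ler_pM2r ?invr_gt0// ler_pXn2r ?nnegrE//; lra.
have d0 := dphi_ge0 w0.
have cw : 0 <= c ^+ 2 / w by rewrite divr_ge0 ?sqr_ge0// ltW.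
have [g0|g0] := leP 0 (gain w); first by rewrite gainn_eq0.
rewrite /gainn ltr0_norm//; move: g0; rewrite /gain; lra.
Qed.

(** Multiplying the gain by [w / (c - phi w)^2] leaves four times the ratio of [mono], minus 1.
    Crossing the threshold [4^-1] is therefore irreversible. *)
Lemma gain_sign (w : R) : 0 < w ->
  (0 <= gain w) = (4^-1 <= w * derive1 phi w / (c - phi w) ^+ 2).
Proof.
move=> w0; have pw : 0 < c - phi w by have := phi_lt w0; lra.
rewrite /gain subr_ge0 ler_pdivrMr// ler_pdivlMr ?exprn_gt0//.
by apply/idP/idP => ?; lra.
Qed.

Lemma is_derive_phi (w : R) : 0 < w -> is_derive w 1 phi (derive1 phi w).
Proof. by move=> w0; split; [exact: dphi|rewrite derive1E]. Qed.

Lemma continuous_phi (w : R) : 0 < w -> {for w, continuous phi}.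
Proof. by move=> w0; exact: is_derive1_continuous (is_derive_phi w0). Qed.

(** The function [1 / (c - phi)] has derivative [phi' / (c - phi)^2], and [w] times this is exactly
    the monotone ratio of [mono]. *)
Lemma continuous_dphi (w : R) : 0 < w -> {for w, continuous (derive1 phi)}.
Proof.
move=> w0.
have psi0 (x : R) : 0 < x -> 0 < c - phi x by move=> /phi_lt; lra.
pose g (x : R) := derive1 phi x / (c - phi x) ^+ 2.
have cg : {for w, continuous g}.
  apply: (@continuous_monotone_derivative _ (fun x => (c - phi x)^-1)) => //.
  - move=> x x0; have dx := is_derive_phi x0.
    have d1 : is_derive x 1 (fun x => c - phi x) (- derive1 phi x).
      apply: is_derive_eq (is_derive1D (is_derive_cst c x 1) (is_deriveN dx)) _.
      by rewrite add0r.
    have px : c - phi x != 0 by rewrite gt_eqF// psi0.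
    apply: is_derive_eq (@is_derive1V _ (fun x => c - phi x) x _ px d1) _.
    by rewrite opprK.
  - by move=> x x0; rewrite divr_ge0 ?dphi_ge0 ?sqr_ge0.
  - by move=> x y x0 xy; rewrite /g !mulrA; exact: mono.
have H : (g x * (c - phi x) ^+ 2 : R) @[x --> w] --> derive1 phi w.
  have -> : derive1 phi w = g w * (c - phi w) ^+ 2.
    by rewrite /g divfK// expf_neq0// gt_eqF// psi0.
  apply: cvgM => //; apply: (@cvg_comp _ _ _ (fun x => c - phi x) (fun y => y ^+ 2)).
    by apply: cvgB; [exact: cvg_cst|exact: continuous_phi].
  exact: exprn_continuous.
have E : \near w, (fun x : R => g x * (c - phi x) ^+ 2) w = derive1 phi w.
  near=> x; rewrite /g divfK// expf_neq0// gt_eqF// psi0//.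
  by near: x; exact: lt_nbhsr.
exact: (cvg_trans (near_eq_cvg E) H).
Unshelve. all: by end_near. Qed.

Lemma continuous_gain (w : R) : 0 < w -> {for w, continuous gain}.
Proof.
move=> w0; apply: cvgB.
  by apply: cvgM; [exact: cvg_cst|exact: continuous_dphi].
apply: cvgM; last by apply: inv_continuous; rewrite gt_eqF.
apply: (@cvg_comp _ _ _ (fun x => c - phi x) (fun y => y ^+ 2)).
  by apply: cvgB; [exact: cvg_cst|exact: continuous_phi].
exact: exprn_continuous.
Qed.

Lemma continuous_gainp (w : R) : 0 < w -> {for w, continuous gainp}.
Proof.
move=> w0; have cg := continuous_gain w0.
by apply: cvgM; [apply: cvgD => //; exact: cvg_norm|exact: cvg_cst].
Qed.

Lemma continuous_gainn (w : R) : 0 < w -> {for w, continuous gainn}.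
Proof.
move=> w0; have cg := continuous_gain w0.
by apply: cvgM; [apply: cvgB => //; exact: cvg_norm|exact: cvg_cst].
Qed.

(* Squared loss at the point r s of a ray, where s is a unit vector making the
   inner product a with the mean, b is the squared norm of the mean and y the
   shrinkage constant. *)
Definition ray_loss (y a b r : R) : R :=
  ((1 - y / r ^+ 2) * r) ^+ 2 - 2 * ((1 - y / r ^+ 2) * r) * a + b.

Definition ray_gauss (a b r : R) : R := expR (- (r ^+ 2 - 2 * r * a + b) / 2).

Section ray.
Variables (a b : R).
Hypothesis ab : a ^+ 2 <= b.

Lemma is_derive_ray_gauss (r : R) :
  is_derive r 1 (ray_gauss a b) (ray_gauss a b r * (a - r)).
Proof.
have dcst (k : R) : is_derive r 1 (fun=> k : R) 0 by exact: is_derive_cst.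
have did : is_derive r 1 (fun x : R => x) 1 by exact: is_derive_id.
have dlin := is_derive1M (is_derive1M (dcst 2) did) (dcst a).
have dpol := is_derive1D (is_derive1D (is_derive1X 2 did) (is_deriveN dlin)) (dcst b).
have dexp := is_derive1_exp (is_derive1M (is_deriveN dpol) (dcst 2^-1)).
by apply: is_derive_eq dexp _; congr (_ * _); rewrite /=; field.
Qed.

Lemma ray_loss_ge0 y r : 0 <= ray_loss y a b r.
Proof.
rewrite /ray_loss; set t := _ * r.
have -> : t ^+ 2 - 2 * t * a + b = (t - a) ^+ 2 + (b - a ^+ 2) by ring.
by rewrite addr_ge0 ?sqr_ge0 ?subr_ge0.
Qed.

(** Integrand of one side of the additive Stein identity; [ray_JS] is the other. The power
    [n.+2 = p - 1] is the polar Jacobian. *)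
Definition ray_phi (r : R) : R :=
  r ^+ n.+2 * ray_gauss a b r * (ray_loss (phi (r ^+ 2)) a b r + gainp (r ^+ 2)).
Definition ray_JS (r : R) : R :=
  r ^+ n.+2 * ray_gauss a b r * (ray_loss c a b r + gainn (r ^+ 2)).
(** Radial flux of the Stein field: Jacobian [r^(p-1)] times radial component [(c - phi) / r] times
    the density; the 2 comes from the cross term of the squared loss. *)
Definition ray_primitive (r : R) : R :=
  2 * (r ^+ n.+1 * (c - phi (r ^+ 2)) * ray_gauss a b r).

(** The mean enters only through [b], so the bound integrates over directions. The singularity
    [1 / r^2] is absorbed by [r^n.+2]; the factorials come from [pow_gauss_le] at the powers [n.+4],
    [n] and [n.+2]. *)
Lemma ray_JS_le r : 0 < r -> ray_JS r <=
  (4 * n.+4`!%:R + 5 * c ^+ 2 * n`!%:R + 2 * b * n.+2`!%:R) * expR (b + 3)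
    * expR (- r).
Proof.
move=> r0; have rr : r != 0 by rewrite gt_eqF.
have b0 : 0 <= b by apply: le_trans ab; exact: sqr_ge0.
have g0 : 0 <= ray_gauss a b r by exact: expR_ge0.
have B k := @pow_gauss_le _ k r a b (ltW r0) ab.
(* With [t = c / r], [(r - t + a)^2 >= 0] bounds the cross term and [(r + t)^2 >= 0] bounds
   [(r - t)^2] by [2 r^2 + 2 t^2]. *)
have l1 : ray_loss c a b r + gainn (r ^+ 2) <= 4 * r ^+ 2 + 5 * c ^+ 2 / r ^+ 2 + 2 * b.
  have := gainn_le (exprn_gt0 2 r0); rewrite /ray_loss.
  have -> : (1 - c / r ^+ 2) * r = r - c / r by field.
  have -> : c ^+ 2 / r ^+ 2 = (c / r) ^+ 2 by rewrite expr_div_n.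
  have -> : 5 * c ^+ 2 / r ^+ 2 = 5 * (c / r) ^+ 2 by field.
  move: (c / r) (gainn _) => t g h.
  have e1 := sqr_ge0 (r - t + a); have e2 := sqr_ge0 (r + t).
  have ab' := ab; rewrite !expr2 in ab' e1 e2 h *; lra.
have h1 : ray_JS r <= r ^+ n.+2 * ray_gauss a b r *
    (4 * r ^+ 2 + 5 * c ^+ 2 / r ^+ 2 + 2 * b).
  by rewrite ler_wpM2l// mulr_ge0// exprn_ge0// ltW.
apply: (le_trans h1).
have -> : r ^+ n.+2 * ray_gauss a b r *
    (4 * r ^+ 2 + 5 * c ^+ 2 / r ^+ 2 + 2 * b) =
    4 * (r ^+ n.+4 * ray_gauss a b r) + 5 * c ^+ 2 * (r ^+ n * ray_gauss a b r)
    + 2 * b * (r ^+ n.+2 * ray_gauss a b r).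
  by rewrite !(exprS r); field.
have b4 : 4 * (r ^+ n.+4 * ray_gauss a b r) <=
    4 * (n.+4`!%:R * expR (b + 3) * expR (- r)) by rewrite ler_wpM2l// B.
have b0' : 5 * c ^+ 2 * (r ^+ n * ray_gauss a b r) <=
    5 * c ^+ 2 * (n`!%:R * expR (b + 3) * expR (- r)).
  by rewrite ler_wpM2l ?B// mulr_ge0 ?sqr_ge0.
have b2 : 2 * b * (r ^+ n.+2 * ray_gauss a b r) <=
    2 * b * (n.+2`!%:R * expR (b + 3) * expR (- r)).
  by rewrite ler_wpM2l ?B// mulr_ge0.
apply: (le_trans (lerD (lerD b4 b0') b2)).
by rewrite le_eqVlt; apply/orP; left; apply/eqP; ring.
Qed.

Lemma ray_primitive_bounds r : 0 < r ->
  0 <= ray_primitive r <= 2 * c * (r ^+ n.+1 * ray_gauss a b r).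
Proof.
move=> r0; have r20 := exprn_gt0 2 r0.
have pw := phi_lt r20; have p0 := phi_ge0 (ltW r20).
have m0 : 0 <= r ^+ n.+1 * ray_gauss a b r.
  by rewrite mulr_ge0 ?expR_ge0// exprn_ge0// ltW.
have -> : ray_primitive r =
    2 * (c - phi (r ^+ 2)) * (r ^+ n.+1 * ray_gauss a b r).
  by rewrite /ray_primitive; ring.
have h0 : 0 <= 2 * (c - phi (r ^+ 2)) by lra.
have h1 : 2 * (c - phi (r ^+ 2)) <= 2 * c by lra.
by rewrite mulr_ge0//= ler_wpM2r.
Qed.

(** [c - phi] is bounded by [c], the Gaussian factor by 1, and [r^(p-2)] has a positive exponent. *)
Lemma ray_primitive_cvg0 : ray_primitive x @[x --> 0^'+] --> 0.
Proof.
apply: (@squeeze_cvgr _ _ _ _ (fun=> 0) (fun r => 2 * c * r ^+ n.+1)).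
- near=> r; have r0 : 0 < r by near: r; exact: nbhs_right_gt.
  have /andP[-> h]/= := ray_primitive_bounds r0; apply: (le_trans h).
  rewrite ler_wpM2l ?mulr_ge0// ler_piMr //; first by rewrite exprn_ge0// ltW.
  rewrite /ray_gauss expR_le1.
  have ab' := ab; have e1 := sqr_ge0 (r - a); rewrite !expr2 in ab' e1 *; lra.
- exact: cvg_cst.
- apply: cvg_at_right_filter.
  have E : 2 * c * 0 ^+ n.+1 = 0 :> R by rewrite expr0n mulr0.
  rewrite -[X in _ --> X]E.
  by apply: cvgM; [exact: cvg_cst|exact: exprn_continuous].
Unshelve. all: by end_near. Qed.

Lemma ray_primitive_cvgy : ray_primitive x @[x --> +oo] --> 0.
Proof.
apply: (@squeeze_cvgr _ _ _ _ (fun=> 0)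
  (fun r => 2 * c * (n.+1`!%:R * expR (b + 3) * expR (- r)))).
- near=> r; have r0 : 0 < r by near: r; exact: nbhs_pinfty_gt.
  have /andP[-> h]/= := ray_primitive_bounds r0; apply: (le_trans h).
  by rewrite ler_wpM2l ?mulr_ge0//; apply: pow_gauss_le => //; exact: ltW.
- exact: cvg_cst.
- have E : 2 * c * (n.+1`!%:R * expR (b + 3) * 0) = 0 :> R by rewrite !mulr0.
  rewrite -[X in _ --> X]E; apply: cvgM; first exact: cvg_cst.
  by apply: cvgM; [exact: cvg_cst|exact: cvgr_expR].
Unshelve. all: by end_near. Qed.

(* Stein's identity along a ray: the divergence of the radial field
   [(c - phi |x|^2) / |x|^2 x] against the Gaussian density. *)
Lemma is_derive_ray_primitive (r : R) : 0 < r ->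
  is_derive r 1 ray_primitive (ray_JS r - ray_phi r).
Proof.
move=> r0; have r20 := exprn_gt0 2 r0.
have dsq : is_derive r 1 (fun x : R => x ^+ 2) (2 * r).
  apply: is_derive_eq (is_derive1X 2 (is_derive_id r 1)) _.
  by rewrite /= expr1 mulr1.
have dphir : is_derive r 1 (fun x : R => phi (x ^+ 2)) (derive1 phi (r ^+ 2) * (2 * r)).
  exact: (@is_derive1_comp _ phi (fun x : R => x ^+ 2)) (is_derive_phi r20) dsq.
have dpsi : is_derive r 1 (fun x : R => c - phi (x ^+ 2))
    (- (derive1 phi (r ^+ 2) * (2 * r))).
  apply: is_derive_eq (is_derive1D (is_derive_cst c r 1) (is_deriveN dphir)) _.
  by rewrite add0r.
have dpow : is_derive r 1 (fun x : R => x ^+ n.+1) (c * r ^+ n).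
  apply: is_derive_eq (is_derive1X n.+1 (is_derive_id r 1)) _.
  by rewrite /= mulr1.
have dg := is_derive_ray_gauss r.
have d2 : is_derive r 1 (fun=> 2 : R) 0 by exact: is_derive_cst.
apply: is_derive_eq (is_derive1M d2 (is_derive1M (is_derive1M dpow dpsi) dg)) _.
rewrite /ray_JS /ray_phi /ray_loss.
(* Once [gainp] is removed, [gainn] with its absolute value is an opaque term that cancels, and
   [field] can conclude. *)
have gE : gainp (r ^+ 2) = gainn (r ^+ 2) + gain (r ^+ 2).
  by rewrite -gainpnB; ring.
rewrite gE /gain !exprS.
by field; rewrite gt_eqF.
Qed.

Lemma continuous_ray_gauss (r : R) : {for r, continuous (ray_gauss a b)}.
Proof.
exact: is_derive1_continuous (is_derive_ray_gauss r).
Qed.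

Lemma cvg_sq_comp (f : R -> R) (r : R) : {for (r ^+ 2), continuous f} ->
  {for r, continuous (fun x : R => f (x ^+ 2))}.
Proof.
by move=> cf; exact: (cvg_comp _ _ (@exprn_continuous _ 2 r) cf).
Qed.

Lemma continuous_ray_loss (y : R -> R) (r : R) : 0 < r -> {for r, continuous y} ->
  {for r, continuous (fun x : R => ray_loss (y x) a b x)}.
Proof.
move=> r0 cy.
have ct : {for r, continuous (fun x : R => (1 - y x / x ^+ 2) * x)}.
  apply: cvgM; last exact: cvg_id.
  apply: cvgB; first exact: cvg_cst.
  apply: cvgM => //; apply: cvgV; last exact: exprn_continuous.
  by rewrite expf_neq0// gt_eqF.
apply: cvgD; last exact: cvg_cst.
apply: cvgB.
  exact: (cvg_comp _ _ ct (@exprn_continuous _ 2 _)).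
apply: cvgM; last exact: cvg_cst.
by apply: cvgM => //; exact: cvg_cst.
Qed.

Lemma continuous_ray_phi (r : R) : 0 < r -> {for r, continuous ray_phi}.
Proof.
move=> r0; have r20 := exprn_gt0 2 r0; apply: cvgM.
  by apply: cvgM; [exact: exprn_continuous|exact: continuous_ray_gauss].
apply: cvgD.
  by apply: continuous_ray_loss => //; apply: cvg_sq_comp; exact: continuous_phi.
by apply: cvg_sq_comp; exact: continuous_gainp.
Qed.

Lemma continuous_ray_JS (r : R) : 0 < r -> {for r, continuous ray_JS}.
Proof.
move=> r0; have r20 := exprn_gt0 2 r0; apply: cvgM.
  by apply: cvgM; [exact: exprn_continuous|exact: continuous_ray_gauss].
apply: cvgD.
  by apply: (@continuous_ray_loss (fun=> c)) => //; exact: cvg_cst.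
by apply: cvg_sq_comp; exact: continuous_gainn.
Qed.

Lemma integral_ray : (\int[mu]_r (posr r * ray_phi r)%:E =
  \int[mu]_r (posr r * ray_JS r)%:E)%E.
Proof.
rewrite !integral_posr; apply: (@integral_balance _ _ _ ray_primitive).
- move=> r r0; rewrite mulr_ge0//.
    by rewrite mulr_ge0 ?expR_ge0// exprn_ge0// ltW.
  by rewrite addr_ge0 ?ray_loss_ge0 ?gainp_ge0.
- move=> r r0; rewrite mulr_ge0//.
    by rewrite mulr_ge0 ?expR_ge0// exprn_ge0// ltW.
  by rewrite addr_ge0 ?ray_loss_ge0 ?gainn_ge0.
- exact: continuous_ray_phi.
- exact: continuous_ray_JS.
- exact: is_derive_ray_primitive.
- exact: ray_primitive_cvg0.
- exact: ray_primitive_cvgy.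
Qed.

End ray.
End risk_gain.

(** * Inner products of sequences and the loss along a ray *)

Section sequences_loss.
Set Implicit Arguments.
Unset Strict Implicit.
Context {R : realType} (p : nat).
Implicit Types (v s th : nat -> R).

Definition dot v th : R := \sum_(i < p) v i * th i.

Lemma sumsqB x s th :
  \sum_(i < p) (x * s i - th i) ^+ 2 =
  x ^+ 2 * sqn p s - 2 * x * dot s th + sqn p th.
Proof.
rewrite /sqn /dot !mulr_sumr -sumrB -big_split/=; apply: eq_bigr => i _; ring.
Qed.

(** Cauchy-Schwarz, from the squared distance of [th] to [a s] with [a = s.th]; [|s| <= 1] also
    covers the zero direction. *)
Lemma dot_direction_le v th : dot (direction p v) th ^+ 2 <= sqn p th.
Proof.
have s1 : sqn p (direction p v) <= 1.
  have [q0|q0] := ltP 0 (sqn p v); first by rewrite sqn_direction.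
  have q00 : sqn p v = 0 by apply/eqP; rewrite eq_le q0 sqn_ge0.
  by rewrite /direction sqnZ q00 mulr0.
set s := direction p v in s1 *; set a := dot s th.
have : 0 <= \sum_(i < p) (a * s i - th i) ^+ 2.
  by apply: sumr_ge0 => i _; exact: sqr_ge0.
rewrite sumsqB -/a => h.
have : a ^+ 2 * sqn p s <= a ^+ 2 by rewrite ler_piMr ?sqr_ge0.
by move: h; rewrite !expr2; lra.
Qed.

Lemma dotN v th : dot (fun j => - v j) th = - dot v th.
Proof. by rewrite /dot -sumrN; apply: eq_bigr => i _; rewrite mulNr. Qed.

Lemma directionN v j : direction p (fun j => - v j) j = - direction p v j.
Proof. by rewrite /direction sqnN mulrN. Qed.

Lemma angular_weightN v : angular_weight p (fun j => - v j) = angular_weight p v.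
Proof. by rewrite /angular_weight /angular_base sqnN. Qed.

Lemma measurable_dot d (T : measurableType d) (X : T -> nat -> R) th :
  (forall i, measurable_fun setT (fun t => X t i)) ->
  measurable_fun setT (fun t => dot (X t) th).
Proof. by move=> mX; apply: measurable_sum => i; exact: measurable_funM. Qed.

Definition loss (y : R -> R) th v : R :=
  \sum_(i < p) ((1 - y (sqn p v) / sqn p v) * v i - th i) ^+ 2.

Lemma loss_ge0 y th v : 0 <= loss y th v.
Proof. by apply: sumr_ge0 => i _; exact: sqr_ge0. Qed.

(** Continuity is known on the open half-line only; the zero extension is measurable on all of
    [R]. *)
Definition patch_pos (y : R -> R) : R -> R := y \_ `]0, +oo[%classic.

Lemma patch_posE y w : 0 < w -> patch_pos y w = y w.
Proof. by move=> w0; rewrite /patch_pos patchE mem_set//= in_itv/= w0. Qed.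

Lemma patch_pos_ge0 y w : (forall x, 0 <= y x) -> 0 <= patch_pos y w.
Proof. by move=> y0; rewrite /patch_pos patchE; case: ifP. Qed.

Lemma measurable_patch_pos (y : R -> R) :
  (forall w : R, 0 < w -> {for w, continuous y}) ->
  measurable_fun [set: R] (patch_pos y).
Proof.
move=> cy; apply: measurable_patch_open; first by apply: interval_open.
by move=> w; rewrite inE/= in_itv/= andbT; exact: cy.
Qed.

(** At [sqn v = 0] the quotient is 0 by convention, so the value of [y] at 0 never shows. *)
Lemma loss_patch_pos y th v : loss (patch_pos y) th v = loss y th v.
Proof.
have [q0|q0] := ltP 0 (sqn p v); first by rewrite /loss patch_posE.
have q00 : sqn p v = 0 by apply/eqP; rewrite eq_le q0 sqn_ge0.
by rewrite /loss q00 invr0 !mulr0.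
Qed.

Lemma measurable_seqfun_sqn (g : R -> R) : measurable_fun [set: R] g ->
  measurable_seqfun (fun v => (g (sqn p v))%:E).
Proof.
move=> mg d T X mX; apply/measurable_EFinP.
exact: (measurableT_comp mg (measurable_sqn p mX)).
Qed.

Lemma measurable_seqfun_loss y th :
  (forall w : R, 0 < w -> {for w, continuous y}) ->
  measurable_seqfun (fun v => (loss y th v)%:E).
Proof.
move=> cy d T X mX; apply/measurable_EFinP.
under eq_fun do rewrite -loss_patch_pos.
apply: measurable_sum => i; apply: measurable_funX; apply: measurable_funB => //.
apply: measurable_funM => //; apply: measurable_funB => //.
apply: measurable_funM.
  exact: (measurableT_comp (measurable_patch_pos cy) (measurable_sqn p mX)).
exact: measurable_invf (measurable_sqn p mX).
Qed.

Lemma loss_ray y th s r : sqn p s = 1 ->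
  loss y th (fun j => r * s j) = ray_loss (y (r ^+ 2)) (dot s th) (sqn p th) r.
Proof.
move=> s1; rewrite /loss sqnZ s1 mulr1.
under eq_bigr do rewrite mulrA.
by rewrite sumsqB s1 mulr1.
Qed.

Lemma radial_weight_ray th s r : sqn p s = 1 ->
  radial_weight p th s r =
  posr r * (r ^+ p.-1 * ray_gauss (dot s th) (sqn p th) r).
Proof. by move=> s1; rewrite /radial_weight sumsqB s1 mulr1. Qed.

End sequences_loss.

(** * Addition and cancellation of nonnegative expectations *)

Section expectations.
Set Implicit Arguments.
Unset Strict Implicit.
Context {R : realType}.
Local Open Scope ereal_scope.

Lemma iter_gaussD (th : nat -> R) p f g :
  measurable_seqfun f -> (forall v, 0 <= f v) ->
  measurable_seqfun g -> (forall v, 0 <= g v) ->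
  iter_gauss th p (fun v => f v + g v) = iter_gauss th p f + iter_gauss th p g.
Proof.
move=> mf f0 mg g0; have [d [T [P [X [mX PX]]]]] := iter_gauss_repr th p.
rewrite !PX//; last 2 first.
- by move=> d' T' Y mY; apply: emeasurable_funD; [exact: mf|exact: mg].
- by move=> v; rewrite adde_ge0.
by rewrite ge0_integralD//; [exact: mf|exact: mg].
Qed.

(** Finiteness of one side makes all four terms real, and then [y - x = z - t]. *)
Lemma le_of_balance (x y z t : \bar R) : 0 <= x -> 0 <= y -> 0 <= z -> 0 <= t ->
  x + z = y + t -> y + t < +oo -> (x <= y) = (t <= z).
Proof.
case: x y z t => [x| |] [y| |] [z| |] [t| |]//= _ _ _ _; rewrite -?EFinD.
by case=> e _; rewrite !lee_fin; apply/idP/idP; lra.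
Qed.

Lemma ler_cosh (x y : R) : (0 <= x -> x <= y ->
  expR x + expR (- x) <= expR y + expR (- y))%R.
Proof.
move=> x0 xy; rewrite -subr_ge0.
have -> : (expR y + expR (- y) - (expR x + expR (- x)) =
  (expR y - expR x) * (1 - expR (- x) * expR (- y)))%R.
  rewrite !expRN; field.
  by rewrite !gt_eqF ?expR_gt0.
rewrite mulr_ge0 ?subr_ge0 ?ler_expR// -expRD -expR0 ler_expR; lra.
Qed.

End expectations.

(** * Likelihood ratio of the radius *)

Section angular.
Set Implicit Arguments.
Unset Strict Implicit.
Context {R : realType} (n : nat).
Local Notation p := n.+3.
Local Notation mu := (@lebesgue_measure R).
Context d (T : measurableType d) (P : probability T R) (Z : T -> nat -> R).
Hypothesis mZ : forall i, measurable_fun setT (fun t => Z t i).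
Hypothesis PZ : forall f, measurable_seqfun f -> (forall v, (0 <= f v)%E) ->
  (iter_gauss (fun=> 0%R) p f = \int[P]_t f (Z t))%E.
Local Open Scope ereal_scope.

Definition angular_mass : \bar R := \int[P]_t (angular_weight p (Z t))%:E.

(** The unnormalised chi density with [p] degrees of freedom. *)
Definition radial_density (r : R) : R := (posr r * (r ^+ n.+2 * expR (- r ^+ 2 / 2)))%R.

Lemma radial_density_ge0 r : (0 <= radial_density r)%R.
Proof.
rewrite /radial_density; have [r0|r0] := ltP 0%R r; last by rewrite posr_le0// mul0r.
by rewrite mulr_ge0 ?posr_ge0// mulr_ge0 ?expR_ge0// exprn_ge0// ltW.
Qed.

Lemma radial_density_le0 r : (r <= 0)%R -> radial_density r = 0%R.
Proof. by move=> r0; rewrite /radial_density posr_le0// mul0r. Qed.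

Lemma measurable_radial_density : measurable_fun [set: R] radial_density.
Proof.
apply: measurable_funM; first exact: measurable_posr.
apply: measurable_funM; first exact: measurable_funX.
apply: measurable_expf; apply: measurable_funM => //; apply: measurable_funN.
exact: measurable_funX.
Qed.

Lemma angular_weight0 v : (sqn p v <= 0)%R -> angular_weight p v = 0%R :> R.
Proof.
move=> q0; have q00 : sqn p v = 0%R by apply/eqP; rewrite eq_le q0 sqn_ge0.
by rewrite /angular_weight /angular_base q00 mulr0 !mul0r.
Qed.

(* The law of the radius has density proportional to
   [radial_density r * angular_tilt th r]. *)
Definition angular_tilt (th : nat -> R) (r : R) : \bar R :=
  \int[P]_t (angular_weight p (Z t) *
    expR (r * dot p (direction p (Z t)) th - sqn p th / 2))%:E.

Lemma angular_tilt_ge0 th r : 0 <= angular_tilt th r.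
Proof.
by apply: integral_ge0 => t _; rewrite lee_fin mulr_ge0 ?expR_ge0 ?angular_weight_ge0.
Qed.

Lemma measurable_tilt d' (T' : measurableType d') (X : T' -> nat -> R) (r : T' -> R) th :
  (forall i, measurable_fun setT (fun t => X t i)) -> measurable_fun setT r ->
  measurable_fun setT (fun t => (angular_weight p (X t) *
    expR (r t * dot p (direction p (X t)) th - sqn p th / 2))%:E).
Proof.
move=> mX mr; apply/measurable_EFinP; apply: measurable_funM.
  exact: measurable_angular_weight.
apply: measurable_expf; apply: measurable_funB => //; apply: measurable_funM => //.
by apply: measurable_dot => i; exact: measurable_direction.
Qed.

Lemma measurable_angular_tilt th : measurable_fun [set: R] (angular_tilt th).
Proof.
apply: (@measurable_fun_fubini_tonelli_F _ _ (measurableTypeR R) _ _ P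
  (fun z => (angular_weight p (Z z.2) *
    expR (z.1 * dot p (direction p (Z z.2)) th - sqn p th / 2))%:E)).
  apply: (@measurable_tilt _ _ (fun z => Z z.2) fst) => // i.
  exact: (measurableT_comp (mZ i) measurable_snd).
by move=> z; rewrite lee_fin mulr_ge0 ?expR_ge0 ?angular_weight_ge0.
Qed.

(** For a unit vector [s], the exponent splits into [- r^2 / 2], which joins [radial_density], and
    [r s.th - |th|^2 / 2], which stays under the angular integral. *)
Lemma radial_expectation th (g : R -> R) : measurable_fun [set: R] g ->
  (forall w, (0 <= g w)%R) ->
  iter_gauss th p (fun v => (g (sqn p v))%:E) =
  \int[mu]_r ((radial_density r * g (r ^+ 2))%:E * angular_tilt th r).
Proof.
move=> mg g0.
have mG : measurable_fun [set: R] (fun r => radial_density r * g (r ^+ 2))%R.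
  apply: measurable_funM; first exact: measurable_radial_density.
  exact: (measurableT_comp mg (measurable_funX 2 (@measurable_id _ R setT))).
have G0 r : (0 <= radial_density r * g (r ^+ 2))%R.
  by rewrite mulr_ge0 ?radial_density_ge0.
rewrite (polar_formula mZ PZ)//; last 2 first.
- exact: measurable_seqfun_sqn.
- by move=> v; rewrite lee_fin.
pose w (t : T) (r : R) := (angular_weight p (Z t) *
    expR (r * dot p (direction p (Z t)) th - sqn p th / 2))%R.
have w0 t r : (0 <= w t r)%R by rewrite mulr_ge0 ?expR_ge0 ?angular_weight_ge0.
transitivity (\int[P]_t \int[mu]_r ((radial_density r * g (r ^+ 2))%:E * (w t r)%:E)).
  apply: eq_integral => t _.
  rewrite -ge0_integralZl; first last.
  - by rewrite lee_fin angular_weight_ge0.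
  - by move=> r _; rewrite mule_ge0// lee_fin// radial_weight_ge0.
  - by apply: (@measurable_ray_integrand _ _ _ _ (fun v => (g (sqn p v))%:E));
      exact: measurable_seqfun_sqn.
  - exact: measurableT.
  apply: eq_integral => r _; rewrite -!EFinM; congr EFin.
  have [q0|q0] := ltP 0%R (sqn p (Z t)); last first.
    by rewrite /w (angular_weight0 q0) !mul0r mulr0.
  rewrite radial_weight_ray ?sqn_direction// sqnZ sqn_direction// mulr1.
  rewrite /w /radial_density /ray_gauss.
  have -> : (- (r ^+ 2 - 2 * r * dot p (direction p (Z t)) th + sqn p th) / 2 =
    - r ^+ 2 / 2 + (r * dot p (direction p (Z t)) th - sqn p th / 2))%R by field.
  by rewrite expRD; ring.
rewrite (@fubini_tonelli _ _ _ (measurableTypeR R) _ P mu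
  (fun z => (radial_density z.2 * g (z.2 ^+ 2))%:E * (w z.1 z.2)%:E))/=; first last.
- by move=> z; rewrite mule_ge0// lee_fin.
- apply: emeasurable_funM.
    apply/measurable_EFinP; exact: (measurableT_comp mG measurable_snd).
  apply: (@measurable_tilt _ _ (fun z => Z z.1) snd) => // i.
  exact: (measurableT_comp (mZ i) measurable_fst).
apply: eq_integral => r _; rewrite ge0_integralZl//.
- exact: (@measurable_tilt _ _ Z (fun=> r)).
- by move=> t _; rewrite lee_fin.
- by rewrite lee_fin.
Qed.

Lemma angular_tilt0 r : angular_tilt (fun=> 0%R) r = angular_mass.
Proof.
apply: eq_integral => t _; congr EFin.
have -> : dot p (direction p (Z t)) (fun=> 0%R) = 0%R.
  by rewrite /dot big1// => i _; rewrite mulr0.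
have -> : sqn p (fun=> 0%R) = 0%R :> R.
  by rewrite /sqn big1// => i _; rewrite expr0n.
by rewrite mulr0 mul0r subrr expR0 mulr1.
Qed.

Lemma angular_mass_ge0 : 0 <= angular_mass.
Proof. by apply: integral_ge0 => t _; rewrite lee_fin angular_weight_ge0. Qed.

(** Mean 0 and [g = 1] in [radial_expectation]. A product equal to 1 makes the mass positive and
    finite without computing any constant. *)
Lemma angular_mass_radial : 1 = \int[mu]_r (radial_density r)%:E * angular_mass.
Proof.
have := @radial_expectation (fun=> 0%R) (fun=> 1%R) (measurable_cst _) (fun=> ler01).
rewrite PZ// integral_cst//= mul1e probability_setT => ->.
rewrite -ge0_integralZr; first last.
- exact: angular_mass_ge0.
- by move=> r _; rewrite lee_fin radial_density_ge0.
- by apply/measurable_EFinP; exact: measurable_radial_density.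
- exact: measurableT.
by apply: eq_integral => r _; rewrite mulr1 angular_tilt0.
Qed.

Lemma angular_mass_lty : angular_mass < +oo.
Proof.
have := angular_mass_radial; have := angular_mass_ge0.
case: angular_mass => [x| |]//; rewrite ?ltry// => _.
set I := integral _ _ _.
have : 0 <= I by apply: integral_ge0 => r _; rewrite lee_fin radial_density_ge0.
rewrite le_eqVlt => /orP[/eqP<-|I0]; first by rewrite mul0e => -[] /eqP; rewrite oner_eq0.
by rewrite gt0_muley.
Qed.

Lemma angular_mass_gt0 : 0 < angular_mass.
Proof.
rewrite lt0e angular_mass_ge0 andbT; apply/eqP => m0.
by have := angular_mass_radial; rewrite m0 mule0 => -[] /eqP; rewrite oner_eq0.
Qed.

Lemma integral_angular_weightM_le (F : T -> \bar R) (C : R) : (0 <= C)%R ->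
  measurable_fun setT F -> (forall t, 0 <= F t) ->
  (forall t, (0 < sqn p (Z t))%R -> F t <= C%:E) ->
  \int[P]_t ((angular_weight p (Z t))%:E * F t) < +oo.
Proof.
move=> C0 mF F0 FC.
have mW : measurable_fun setT (fun t => (angular_weight p (Z t))%:E).
  by apply/measurable_EFinP; exact: measurable_angular_weight.
have W0 t : 0 <= (angular_weight p (Z t))%:E by rewrite lee_fin angular_weight_ge0.
apply: (@le_lt_trans _ _ (\int[P]_t ((angular_weight p (Z t))%:E * C%:E))).
  apply: ge0_le_integral => //.
  - by move=> t _; rewrite mule_ge0.
  - exact: emeasurable_funM.
  - exact: emeasurable_funM.
  - move=> t _; have [q0|q0] := ltP 0%R (sqn p (Z t)).
      by rewrite lee_wpmul2l// FC.
    by rewrite (angular_weight0 q0) !mul0e.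
rewrite ge0_integralZr; first last.
- by rewrite lee_fin.
- by move=> t _; exact: W0.
- exact: mW.
- exact: measurableT.
rewrite -/angular_mass; have := angular_mass_lty; have := angular_mass_ge0.
by case: angular_mass => [x| |]//= _; rewrite ?ltxx// -EFinM !ltry.
Qed.

Lemma angular_tilt_lty th r : angular_tilt th r < +oo.
Proof.
rewrite /angular_tilt; under eq_integral do rewrite EFinM.
apply: (@integral_angular_weightM_le _ (expR (r ^+ 2 / 2))).
- exact: expR_ge0.
- apply/measurable_EFinP; apply: measurable_expf; apply: measurable_funB => //.
  apply: measurable_funM => //; apply: measurable_dot => i.
  exact: measurable_direction.
- by move=> t; rewrite lee_fin expR_ge0.
- move=> t _; rewrite lee_fin ler_expR.
  have h1 := @dot_direction_le _ p (Z t) th.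
  have h2 := sqr_ge0 (r - dot p (direction p (Z t)) th).
  rewrite !expr2 in h1 h2 *; lra.
Qed.

(** The standard Gaussian is symmetric: [iter_gauss_scale] at -1 has all weights 1, and negating [v]
    flips the direction but keeps [angular_weight]. *)
Lemma angular_tiltN th r : angular_tilt th (- r) = angular_tilt th r.
Proof.
pose F (v : nat -> R) := (angular_weight p v *
  expR (r * dot p (direction p v) th - sqn p th / 2))%:E.
have mF : measurable_seqfun F.
  by move=> d' T' X mX; apply: (@measurable_tilt _ _ _ (fun=> r)).
have F0 v : 0 <= F v by rewrite lee_fin mulr_ge0 ?expR_ge0 ?angular_weight_ge0.
have mFN : measurable_seqfun (fun v => F (fun j => - v j)%R).
  by move=> d' T' X mX; apply: (mF _ _ (fun t j => - X t j)%R) => i; exact: measurable_funN.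
transitivity (\int[P]_t F (fun j => - Z t j)%R).
  apply: eq_integral => t _; rewrite /F angular_weightN.
  have -> : dot p (direction p (fun j => - Z t j)%R) th =
      (- dot p (direction p (Z t)) th)%R.
    by rewrite -dotN; congr (dot _ _ _); apply/funext => j; rewrite directionN.
  by rewrite mulrN mulNr.
have -> : angular_tilt th r = iter_gauss (fun=> 0%R) p F by rewrite PZ.
rewrite -(PZ mFN (fun=> F0 _)).
have N10 : (-1)%R != 0%R :> R by rewrite oppr_eq0 oner_eq0.
rewrite (iter_gauss_scale (fun=> 0%R) (-1)%R p F N10 mF F0).
congr (iter_gauss _ _ _); apply/funext => v.
rewrite big1 ?mul1e; last first.
  move=> i _; rewrite /scale_weight normrN1 mul1r mulN1r subr0 sqrrN mulNr.
  by rewrite addNr expR0.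
by congr F; apply/funext => j; rewrite mulN1r.
Qed.

(** For one direction [expR (r * a)] decreases when [a < 0]; adding the tilts at [r] and [- r] turns
    it into a hyperbolic cosine. Evenness and finiteness of the tilt then remove the doubling. *)
Lemma angular_tilt_nondecreasing th r1 r2 : (0 <= r1)%R -> (r1 <= r2)%R ->
  angular_tilt th r1 <= angular_tilt th r2.
Proof.
move=> r10 r12.
have F0 r t : 0 <= (angular_weight p (Z t) *
    expR (r * dot p (direction p (Z t)) th - sqn p th / 2))%:E.
  by rewrite lee_fin mulr_ge0 ?expR_ge0 ?angular_weight_ge0.
have mF r := @measurable_tilt _ _ Z (fun=> r) th mZ (measurable_cst _).
have : angular_tilt th r1 + angular_tilt th (- r1) <=
    angular_tilt th r2 + angular_tilt th (- r2).
  rewrite -!ge0_integralD//; try exact: mF.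
  apply: ge0_le_integral => //.
  - by move=> t _; rewrite adde_ge0.
  - by apply: emeasurable_funD; exact: mF.
  - by apply: emeasurable_funD; exact: mF.
  move=> t _; rewrite -!EFinD lee_fin -!mulrDr ler_wpM2l ?angular_weight_ge0//.
  set a := dot _ _ _; set b := (sqn p th / 2)%R.
  rewrite !expRD -!mulrDl ler_wpM2r ?expR_ge0// !mulNr.
  have cosh_abs x : (expR (x * a) + expR (- (x * a)) =
      expR (x * `|a|) + expR (- (x * `|a|)))%R.
    have [a0|a0] := leP 0%R a; first by rewrite ger0_norm.
    by rewrite ltr0_norm// mulrN opprK addrC.
  rewrite (cosh_abs r1) (cosh_abs r2).
  by apply: ler_cosh; [rewrite mulr_ge0|rewrite ler_wpM2r].
rewrite !angular_tiltN.
have := angular_tilt_lty th r1; have := angular_tilt_lty th r2.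
have := angular_tilt_ge0 th r1; have := angular_tilt_ge0 th r2.
case: (angular_tilt th r1) (angular_tilt th r2) => [x| |] [y| |]//= _ _ _ _.
by rewrite -!EFinD !lee_fin; lra.
Qed.

End angular.

(** * Comparison of the risks *)

Section dominance.
Set Implicit Arguments.
Unset Strict Implicit.
Context {R : realType} (n : nat) (phi : R -> R).
Local Notation p := n.+3.
Local Notation c := (n.+1%:R : R).
Local Notation mu := (@lebesgue_measure R).

Hypothesis dphi : forall w : R, 0 < w -> derivable phi w 1.
Hypothesis phi_lt : forall w : R, 0 < w -> phi w < c.
Hypothesis dphi_ge0 : forall w : R, 0 < w -> 0 <= derive1 phi w.
Hypothesis phi_ge0 : forall w : R, 0 <= w -> 0 <= phi w.
Hypothesis mono : forall w1 w2 : R, 0 < w1 -> w1 <= w2 ->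
  w1 * derive1 phi w1 / (c - phi w1) ^+ 2 <= w2 * derive1 phi w2 / (c - phi w2) ^+ 2.

Context d (T : measurableType d) (P : probability T R) (Z : T -> nat -> R).
Hypothesis mZ : forall i, measurable_fun setT (fun t => Z t i).
Hypothesis PZ : forall f, measurable_seqfun f -> (forall v, (0 <= f v)%E) ->
  (iter_gauss (fun=> 0%R) p f = \int[P]_t f (Z t))%E.

Local Notation gp := (patch_pos (gainp n phi)).
Local Notation gn := (patch_pos (gainn n phi)).

Let gp0 w : 0 <= gp w. Proof. by apply: patch_pos_ge0 => x; exact: gainp_ge0. Qed.
Let gn0 w : 0 <= gn w. Proof. by apply: patch_pos_ge0 => x; exact: gainn_ge0. Qed.

Let mgp : measurable_fun [set: R] gp.
Proof. by apply: measurable_patch_pos => w w0; exact: continuous_gainp. Qed.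
Let mgn : measurable_fun [set: R] gn.
Proof. by apply: measurable_patch_pos => w w0; exact: continuous_gainn. Qed.

Local Notation Ephi th := (iter_gauss th p (fun v => (loss p phi th v)%:E)).
Local Notation EJS th := (iter_gauss th p (fun v => (loss p (fun=> c) th v)%:E)).
Local Notation Ep th := (iter_gauss th p (fun v => (gp (sqn p v))%:E)).
Local Notation En th := (iter_gauss th p (fun v => (gn (sqn p v))%:E)).

Local Open Scope ereal_scope.

Let mlphi th : measurable_seqfun (fun v => (loss p phi th v)%:E).
Proof. by apply: measurable_seqfun_loss => w w0; exact: continuous_phi. Qed.
Let mlJS th : measurable_seqfun (fun v => (loss p (fun=> c) th v)%:E).
Proof. by apply: measurable_seqfun_loss => w w0; exact: cvg_cst. Qed.

Local Notation fphi th := (fun v : nat -> R => (loss p phi th v)%:E + (gp (sqn p v))%:E).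
Local Notation fJS th := (fun v : nat -> R => (loss p (fun=> c) th v)%:E + (gn (sqn p v))%:E).

Let fphi_ge0 th v : 0 <= fphi th v.
Proof. by rewrite adde_ge0// lee_fin ?loss_ge0. Qed.
Let fJS_ge0 th v : 0 <= fJS th v.
Proof. by rewrite adde_ge0// lee_fin ?loss_ge0. Qed.
Let mfphi th : measurable_seqfun (fphi th).
Proof.
move=> d' T' X mX; apply: emeasurable_funD; first exact: mlphi.
exact: (measurable_seqfun_sqn p mgp).
Qed.
Let mfJS th : measurable_seqfun (fJS th).
Proof.
move=> d' T' X mX; apply: emeasurable_funD; first exact: mlJS.
exact: (measurable_seqfun_sqn p mgn).
Qed.

Let ray_phiE th s r : sqn p s = 1%R ->
  (radial_weight p th s r)%:E * fphi th (fun j => r * s j)%R =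
  (posr r * ray_phi n phi (dot p s th) (sqn p th) r)%:E.
Proof.
move=> s1; rewrite radial_weight_ray// -EFinD -EFinM; congr EFin.
have [r0|r0] := ltP 0%R r; last by rewrite posr_le0// !mul0r.
rewrite sqnZ s1 mulr1 patch_posE ?exprn_gt0// loss_ray// /ray_phi.
by rewrite !mulrA.
Qed.

Let ray_JSE th s r : sqn p s = 1%R ->
  (radial_weight p th s r)%:E * fJS th (fun j => r * s j)%R =
  (posr r * ray_JS n phi (dot p s th) (sqn p th) r)%:E.
Proof.
move=> s1; rewrite radial_weight_ray// -EFinD -EFinM; congr EFin.
have [r0|r0] := ltP 0%R r; last by rewrite posr_le0// !mul0r.
rewrite sqnZ s1 mulr1 patch_posE ?exprn_gt0// loss_ray// /ray_JS.
by rewrite !mulrA.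
Qed.

Let EphiD th : iter_gauss th p (fphi th) = Ephi th + Ep th.
Proof.
apply: iter_gaussD.
- exact: mlphi.
- by move=> v; rewrite lee_fin loss_ge0.
- exact: measurable_seqfun_sqn.
- by move=> v; rewrite lee_fin.
Qed.

Let EJSD th : iter_gauss th p (fJS th) = EJS th + En th.
Proof.
apply: iter_gaussD.
- exact: mlJS.
- by move=> v; rewrite lee_fin loss_ge0.
- exact: measurable_seqfun_sqn.
- by move=> v; rewrite lee_fin.
Qed.

(** In polar form both sides have the same angular weight, so they agree direction by direction
    through [integral_ray]. *)
Lemma stein_balance th : Ephi th + Ep th = EJS th + En th.
Proof.
have e1 := @polar_formula _ _ _ _ _ _ mZ PZ th _ isT (mfphi th) (fphi_ge0 th).
have e2 := @polar_formula _ _ _ _ _ _ mZ PZ th _ isT (mfJS th) (fJS_ge0 th).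
apply: (etrans (esym (EphiD th))); apply: (etrans e1).
apply: esym; apply: (etrans (esym (EJSD th))); apply: (etrans e2); apply: esym.
apply: eq_integral => t _.
have [q0|q0] := ltP 0%R (sqn p (Z t)); last by rewrite (angular_weight0 q0) !mul0e.
have s1 := sqn_direction q0.
congr (_ * _).
under eq_integral do rewrite ray_phiE//.
under [RHS]eq_integral do rewrite ray_JSE//.
by apply: integral_ray => //; exact: dot_direction_le.
Qed.

(** Each ray integral is at most [K] times the integral of [expR (- r)], with [K] independent of the
    direction, and the angular mass is finite. *)
Lemma stein_finite th : EJS th + En th < +oo.
Proof.
have e2 := @polar_formula _ _ _ _ _ _ mZ PZ th _ isT (mfJS th) (fJS_ge0 th).
have -> : EJS th + En th = _ := etrans (esym (EJSD th)) e2.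
pose b := sqn p th.
pose K := ((4 * n.+4`!%:R + 5 * c ^+ 2 * n`!%:R + 2 * b * n.+2`!%:R) * expR (b + 3))%R.
have b0 : (0 <= b)%R by exact: sqn_ge0.
have K0 : (0 <= K)%R.
  by rewrite mulr_ge0 ?expR_ge0// !addr_ge0// ?mulr_ge0// sqr_ge0.
have I0 : 0 <= \int[mu]_r (posr r * expR (- r))%:E.
  by apply: integral_ge0 => r _; rewrite lee_fin mulr_ge0 ?posr_ge0 ?expR_ge0.
have mexp : measurable_fun [set: R] (fun r => (posr r * expR (- r))%:E).
  apply/measurable_EFinP; apply: measurable_funM; first exact: measurable_posr.
  by apply: measurable_expf; exact: measurable_funN.
have mray s : measurable_fun [set: R] (fun r => (radial_weight p th s r)%:E *
    fJS th (fun j => r * s j)%R).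
  exact: (measurable_ray_integrand p th s (mfJS th)).
have ray0 s r : 0 <= (radial_weight p th s r)%:E * fJS th (fun j => r * s j)%R.
  by rewrite mule_ge0// lee_fin radial_weight_ge0.
apply: (@integral_angular_weightM_le _ _ _ _ _ _ mZ PZ _
  (K * fine (\int[mu]_r (posr r * expR (- r))%:E))%R).
- by rewrite mulr_ge0// fine_ge0.
- apply: (@measurable_fun_fubini_tonelli_F _ _ _ (measurableTypeR R) _ mu
    (fun z => (radial_weight p th (direction p (Z z.1)) z.2)%:E *
       fJS th (fun j => z.2 * direction p (Z z.1) j)%R)).
    have mD i : measurable_fun setT
        (fun z : T * measurableTypeR R => direction p (Z z.1) i).
      apply: (@measurable_direction _ _ _ _ (fun z => Z z.1)) => j.
      exact: (measurableT_comp (mZ j) measurable_fst).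
    apply: emeasurable_funM.
      apply/measurable_EFinP.
      exact: (@measurable_radial_weight _ _ _ _ (fun z => direction p (Z z.1)) snd).
    apply: (@mfJS th _ (T * measurableTypeR R)%type
      (fun z j => z.2 * direction p (Z z.1) j)%R) => i.
    exact: measurable_funM.
  by move=> z; exact: ray0.
- by move=> t; apply: integral_ge0 => r _; exact: ray0.
- move=> t q0; rewrite EFinM fineK ?ge0_fin_numE ?integral_exp_half_line//.
  rewrite -ge0_integralZl; first last.
  + by rewrite lee_fin.
  + by move=> r _; rewrite lee_fin mulr_ge0 ?posr_ge0 ?expR_ge0.
  + exact: mexp.
  + exact: measurableT.
  apply: ge0_le_integral.
  + exact: measurableT.
  + by move=> r _; exact: ray0.
  + exact: mray.
  + by apply: measurable_funeM; exact: mexp.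
  move=> r _; rewrite (ray_JSE _ _ (sqn_direction q0)) -EFinM lee_fin.
  have [r0|r0] := ltP 0%R r; last by rewrite !posr_le0// !mul0r mulr0.
  rewrite !posr_gt0// !mul1r; apply: ray_JS_le => //; exact: dot_direction_le.
Qed.

Lemma risk_le_gain th : (Ephi th <= EJS th) = (En th <= Ep th).
Proof.
apply: le_of_balance; try by apply: iter_gauss_ge0 => v; rewrite lee_fin ?loss_ge0.
  exact: stein_balance.
exact: stein_finite.
Qed.

Local Notation Kp := (\int[mu]_r (radial_density n r * gp (r ^+ 2))%:E).
Local Notation Kn := (\int[mu]_r (radial_density n r * gn (r ^+ 2))%:E).

Let mK (g : R -> R) : measurable_fun [set: R] g ->
  measurable_fun [set: R] (fun r => (radial_density n r * g (r ^+ 2))%:E).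
Proof.
move=> mg; apply/measurable_EFinP; apply: measurable_funM.
  exact: measurable_radial_density.
exact: (measurableT_comp mg (measurable_funX 2 (@measurable_id _ R setT))).
Qed.

Let K0 (g : R -> R) r : (forall w, (0 <= g w)%R) ->
  0 <= (radial_density n r * g (r ^+ 2))%:E.
Proof. by move=> g0; rewrite lee_fin mulr_ge0 ?radial_density_ge0. Qed.

Let central (g : R -> R) : measurable_fun [set: R] g -> (forall w, (0 <= g w)%R) ->
  iter_gauss (fun=> 0%R) p (fun v => (g (sqn p v))%:E) =
  \int[mu]_r (radial_density n r * g (r ^+ 2))%:E * angular_mass n P Z.
Proof.
move=> mg g0; rewrite (radial_expectation mZ PZ)// -ge0_integralZr; first last.
- exact: angular_mass_ge0.
- by move=> r _; exact: K0.
- exact: mK.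
- exact: measurableT.
by apply: eq_integral => r _; rewrite angular_tilt0.
Qed.

Let mtilt (g : R -> R) (l : R -> \bar R) : measurable_fun [set: R] g ->
  measurable_fun [set: R] l -> measurable_fun [set: R]
    (fun r => (radial_density n r * g (r ^+ 2))%:E * l r).
Proof. by move=> mg ml; apply: emeasurable_funM => //; exact: mK. Qed.

(* Monotone likelihood ratio: the tilt is nondecreasing in the radius while the
   gain changes sign only once, from negative to nonnegative. *)
Lemma gain_tilt th : En (fun=> 0%R) <= Ep (fun=> 0%R) -> En th <= Ep th.
Proof.
(* At the origin the tilt is the constant [angular_mass], which cancels because it is positive and
   finite. *)
move=> E0; have Knp : Kn <= Kp.
  move: E0; have -> : En (fun=> 0%R) = Kn * angular_mass n P Z := central mgn gn0.
  have -> : Ep (fun=> 0%R) = Kp * angular_mass n P Z := central mgp gp0.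
  rewrite lee_pmul2r//; last exact: (angular_mass_gt0 mZ PZ).
  by rewrite ge0_fin_numE ?angular_mass_ge0// (angular_mass_lty mZ PZ).
pose l := angular_tilt n P Z th.
have -> : En th = \int[mu]_r ((radial_density n r * gn (r ^+ 2))%:E * l r) :=
  radial_expectation mZ PZ th mgn gn0.
have -> : Ep th = \int[mu]_r ((radial_density n r * gp (r ^+ 2))%:E * l r) :=
  radial_expectation mZ PZ th mgp gp0.
have ml : measurable_fun [set: R] l by exact: measurable_angular_tilt.
have l0 r : 0 <= l r by exact: angular_tilt_ge0.
(* If the gain is negative everywhere there is no crossing radius; then [Kp = 0] forces [Kn = 0],
   and the tilted integral of [gn] vanishes almost everywhere in its integrand. *)
have [[w1 [w10 gw1]]|noneg] := pselect (exists w, (0 < w)%R /\ (0 <= gain n phi w)%R);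
  last first.
  have Kp0 : Kp = 0.
    apply: integral0_eq => r _.
    have [r0|r0] := ltP 0%R r; last first.
      by rewrite /radial_density posr_le0// !mul0r.
    rewrite patch_posE ?exprn_gt0// gainp_eq0 ?mulr0//.
    rewrite leNgt; apply/negP => /ltW g0; apply: noneg.
    by exists (r ^+ 2)%R; rewrite exprn_gt0.
  have Kn0 : Kn = 0.
    apply/eqP; rewrite eq_le -{1}Kp0 Knp/=.
    by apply: integral_ge0 => r _; exact: K0.
  have ae0 : ae_eq mu setT (fun r => (radial_density n r * gn (r ^+ 2))%:E) (cst 0).
    apply/ae_eq_integral_abs => //; first exact: mK.
    rewrite -[RHS]Kn0; apply: eq_integral => r _; rewrite gee0_abs//.
    exact: K0.
  rewrite (@ge0_ae_eq_integral _ _ _ mu setT _ (cst 0)).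
  - rewrite integral0; apply: integral_ge0 => r _; rewrite mule_ge0//.
    exact: K0.
  - exact: measurableT.
  - exact: mtilt.
  - exact: measurable_cst.
  - by move=> r _; rewrite mule_ge0//; exact: K0.
  - by [].
  - move: ae0; apply: filterS => r /(_ I)/= -> _; exact: mul0e.
pose A := [set r : R | (0 < r)%R /\ (0 <= gain n phi (r ^+ 2))%R].
have Ar1 : A (Num.sqrt w1) by split; rewrite ?sqrtr_gt0// sqr_sqrtr// ltW.
have lbA : lbound A 0%R by move=> r [/ltW].
have infA : has_inf A by split; [exists (Num.sqrt w1)|exists 0%R].
(* The crossing radius, possibly 0. [gn] lives on [r <= r0] and [gp] on [r >= r0], so comparing [l]
   with [l r0] gives one inequality for each. *)
pose r0 := inf A.
have r00 : (0 <= r0)%R by apply: lb_le_inf => //; exists (Num.sqrt w1).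
have below r : (0 < r)%R -> (r < r0)%R -> (gain n phi (r ^+ 2) <= 0)%R.
  move=> rp rr0; rewrite leNgt; apply/negP => /ltW g0.
  have : (r0 <= r)%R by apply: ge_inf; [exists 0%R|split].
  by rewrite leNgt rr0.
have above r : (0 < r)%R -> (r0 < r)%R -> (0 <= gain n phi (r ^+ 2))%R.
  move=> rp rr; have [x [x0 gx] xr] := inf_lt infA.1 rr.
  have x20 := exprn_gt0 2 x0; have r20 := exprn_gt0 2 rp.
  move: gx; rewrite !gain_sign// => /le_trans; apply; apply: mono => //.
  by rewrite ler_pXn2r ?nnegrE ?ltW.
have step1 : \int[mu]_r ((radial_density n r * gn (r ^+ 2))%:E * l r) <= Kn * l r0.
  rewrite -ge0_integralZr; first last.
  - exact: l0.
  - by move=> r _; exact: K0.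
  - exact: mK.
  - exact: measurableT.
  apply: ge0_le_integral.
  - exact: measurableT.
  - by move=> r _; rewrite mule_ge0//; exact: K0.
  - exact: (mtilt mgn ml).
  - exact: (mtilt mgn (measurable_cst (l r0))).
  move=> r _; have [rp|rp] := ltP 0%R r; last first.
    by rewrite (radial_density_le0 n rp) mul0r !mul0e.
  have [rr0|rr0] := leP r r0.
    apply: lee_wpmul2l; first exact: K0.
    by apply: angular_tilt_nondecreasing => //; exact: ltW.
  have -> : gn (r ^+ 2)%R = 0%R.
    by rewrite patch_posE ?exprn_gt0// gainn_eq0// above.
  by rewrite mulr0 !mul0e.
have step2 : Kp * l r0 <= \int[mu]_r ((radial_density n r * gp (r ^+ 2))%:E * l r).
  rewrite -ge0_integralZr; first last.
  - exact: l0.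
  - by move=> r _; exact: K0.
  - exact: mK.
  - exact: measurableT.
  apply: ge0_le_integral.
  - exact: measurableT.
  - by move=> r _; rewrite mule_ge0//; exact: K0.
  - exact: (mtilt mgp (measurable_cst (l r0))).
  - exact: (mtilt mgp ml).
  move=> r _; have [rp|rp] := ltP 0%R r; last first.
    by rewrite (radial_density_le0 n rp) mul0r !mul0e.
  have [rr0|rr0] := leP r0 r.
    apply: lee_wpmul2l; first exact: K0.
    by apply: angular_tilt_nondecreasing.
  have -> : gp (r ^+ 2)%R = 0%R.
    by rewrite patch_posE ?exprn_gt0// gainp_eq0// below.
  by rewrite mulr0 !mul0e.
apply: (le_trans step1); apply: le_trans step2.
by rewrite lee_wpmul2r.
Qed.

Lemma loss_dominance : Ephi (fun=> 0%R) <= EJS (fun=> 0%R) ->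
  forall th, Ephi th <= EJS th.
Proof.
move=> h0 th; rewrite (risk_le_gain th); apply: gain_tilt.
by rewrite -(risk_le_gain (fun=> 0%R)).
Qed.

End dominance.

(** * From sequences back to row vectors *)

Lemma coordsE (R : realType) (p : nat) (theta : 'rV[R]_p) (i : 'I_p) :
  coords theta i = theta 0 i.
Proof. by rewrite /coords insubT//= => ilt; congr (theta 0 _); exact: val_inj. Qed.

Lemma riskE {R : realType} {p : nat} (phi : R -> R) (theta : 'rV[R]_p) :
  risk theta (est_phi phi) =
  iter_gauss (coords theta) p (fun v => (loss p phi (coords theta) v)%:E).
Proof.
congr iter_gauss; apply/funext => v; congr EFin.
rewrite /loss /sqnorm /est_phi.
have -> : sqnorm (\row_(i < p) v i) = sqn p v.
  by apply: eq_bigr => i _; rewrite mxE.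
by apply: eq_bigr => i _; rewrite !mxE coordsE.
Qed.

Lemma riskJSE {R : realType} {p : nat} (theta : 'rV[R]_p) :
  risk theta (@est_JS R p) = iter_gauss (coords theta) p
    (fun v => (loss p (fun=> (p - 2)%:R) (coords theta) v)%:E).
Proof. exact: riskE. Qed.

Lemma coords0 (R : realType) (p : nat) : coords (0 : 'rV[R]_p) = fun=> 0.
Proof.
by apply/funext => j; rewrite /coords; case: insubP => // i _ _; rewrite mxE.
Qed.

Theorem theorem1 (R : realType) (p : nat) (phi : R -> R) :
  (3 <= p)%N ->
  (* phi differentiable on [0, oo): two-sided on (0, oo), right at 0 *)
  (forall w : R, 0 < w -> derivable phi w 1) ->
  (* (A.1) at w = 0: the right derivative exists and is >= 0 *)
  (exists d : R, 0 <= d /\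
     (fun h : R => h^-1 * (phi h - phi 0)) @ 0^'+ --> d) ->
  (forall w : R, 0 < w -> phi w < (p - 2)%:R) ->
  (* (A.1) for w > 0 *)
  (forall w : R, 0 < w -> 0 <= derive1 phi w) ->
  (* (A.2) *)
  (forall w : R, 0 <= w -> 0 <= phi w) ->
  (* (A.4) *)
  phi x @[x --> +oo] --> ((p - 2)%:R : R) ->
  (* (A.6) *)
  (forall w1 w2 : R, 0 < w1 -> w1 <= w2 ->
     w1 * derive1 phi w1 / ((p - 2)%:R - phi w1) ^+ 2
     <= w2 * derive1 phi w2 / ((p - 2)%:R - phi w2) ^+ 2) ->
  (* (A.7) *)
  (risk (0 : 'rV[R]_p) (est_phi phi) <= risk 0 (@est_JS R p))%E ->
  forall theta : 'rV[R]_p,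
    (risk theta (est_phi phi) <= risk theta (@est_JS R p))%E.
Proof.
(* With [p = n.+3], the truncated [p - 2] and [p.-1] compute to [n.+1] and [n.+2]. *)
move=> p3; have [n ->] : exists n, p = n.+3 by exists (p - 3)%N; rewrite -addn3 subnK.
move=> dphi _ phi_lt dphi_ge0 phi_ge0 _ mono risk0 theta.
have [d [T [P [Z [mZ PZ]]]]] := iter_gauss_repr (fun=> 0 : R) n.+3.
move: risk0; rewrite (riskE phi 0) (riskE phi theta) (riskJSE 0) (riskJSE theta).
have e2 : (n.+3 - 2 = n.+1)%N by [].
rewrite e2 in phi_lt mono *; rewrite coords0 => risk0.
exact: (loss_dominance dphi phi_lt dphi_ge0 phi_ge0 mono mZ PZ risk0).
Qed.
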